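(* Let $f:\mathbb{R}^n\to\mathbb{R}$ be continuous, and suppose that $f$ is differentiable at every point outside some $\sigma$-tangential set. Suppose that $Mf\not\equiv\infty$. Then $Mf$ is continuous, and $Mf$ is differentiable at every point outside some $\sigma$-tangential set.
   Context: $Mf(x)=\sup_{r>0}\frac{1}{|B(x,r)|}\int_{B(x,r)}|f(y)|\,dy$ is the (centered) Hardy-Littlewood maximal function, with values in $[0,\infty]$. For a linear subspace $V\subset\mathbb{R}^n$ write each $h\in\mathbb{R}^n$ as $h=h^V+h^{V^\perp}$ with $h^V\in V$, $h^{V^\perp}\in V^\perp$. A set $E\subset\mathbb{R}^n$ is tangential if for every $x\in E$ there is an $(n-1)$-dimensional linear subspace $V_x$ such that whenever $h_i\ne0$, $x+h_i\in E$ and $h_i\to0$ as $i\to\infty$, one has $|h_i^{V_x^\perp}|/|h_i^{V_x}|\to0$ as $i\to\infty$ (the quotient being understood as $+\infty$ if $h_i^{V_x}=0$). A set is $\sigma$-tangential if it can be covered by a countable union of tangential sets. *)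

(* Defs.v *)
From HB Require Import structures.
From mathcomp Require Import all_boot all_order all_algebra.
From mathcomp Require Import all_classical all_reals all_analysis.
Set Implicit Arguments.
Unset Strict Implicit.
Unset Printing Implicit Defensive.
Import Order.TTheory GRing.Theory Num.Theory.
Import numFieldNormedType.Exports.
Local Open Scope classical_set_scope.
Local Open Scope ring_scope.

(* R^n is 'rV[R]_n. Its library topology comes from the sup norm and agrees
   with the Euclidean one, so `continuous` and `differentiable` have their usual
   meaning; lengths and balls below are Euclidean. *)

Section measurable_rV.
Context d (T : measurableType d) (n : nat).

Let coord : 'I_n -> 'rV[T]_n -> T := fun i v => v ord0 i.

Let rV_set0 : g_sigma_preimage coord set0.
Proof. exact: sigma_algebra0. Qed.

Let rV_setC A : g_sigma_preimage coord A -> g_sigma_preimage coord (~` A).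
Proof. exact: sigma_algebraC. Qed.

Let rV_bigcup (F : (set 'rV[T]_n)^nat) :
  (forall i, g_sigma_preimage coord (F i)) ->
  g_sigma_preimage coord (\bigcup_i F i).
Proof. exact: sigma_algebra_bigcup. Qed.

(* product sigma-algebra, i.e. the Borel sets when T is R *)
HB.instance Definition _ := @isMeasurable.Build (measure_tuple_display d)
  'rV[T]_n (g_sigma_preimage coord) rV_set0 rV_setC rV_bigcup.

End measurable_rV.

Lemma measurable_rV_coord d (T : measurableType d) n (i : 'I_n) :
  measurable_fun [set: 'rV[T]_n] (fun v => v ord0 i).
Proof.
move=> _ Y mY; rewrite setTI; apply: sub_sigma_algebra => /=.
rewrite -bigcup_seq/=; exists i => /=; first by rewrite mem_index_enum.
by exists Y => //; rewrite setTI.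
Qed.

Lemma measurable_fun_rV d1 d2 (T1 : measurableType d1) (T2 : measurableType d2)
    n (f : T1 -> 'rV[T2]_n) :
  (forall i, measurable_fun [set: T1] (fun x => f x ord0 i)) ->
  measurable_fun [set: T1] f.
Proof.
move=> mf.
suff H : g_sigma_preimage (fun i (v : 'rV[T2]_n) => v ord0 i) `<=`
    image_set_system setT f measurable by move=> _ A /H.
apply: smallest_sub.
  exact/sigma_algebra_image/sigma_algebra_measurable.
elim/big_ind: _ => //; first by move=> A B sA sB C [/sA|/sB].
move=> i _ _ [B mB <-]; rewrite /image_set_system/= setTI.
exact: mf.
Qed.

Section lebesgue_rV.
Context (R : realType).

Definition consrV n (p : 'rV[R]_n * measurableTypeR R) : 'rV[R]_n.+1 := row_mx p.2%:M p.1.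

Lemma consrV0 n (p : 'rV[R]_n * measurableTypeR R) : consrV p ord0 ord0 = p.2.
Proof.
rewrite /consrV (_ : ord0 = lshift n (ord0 : 'I_1)); last exact/val_inj.
by rewrite (@row_mxEl R 1 1 n) mxE eqxx mulr1n.
Qed.

Lemma consrVS n (p : 'rV[R]_n * measurableTypeR R) (i : 'I_n) :
  consrV p ord0 (lift ord0 i) = p.1 ord0 i.
Proof.
rewrite /consrV (_ : lift ord0 i = rshift 1 i); last exact/val_inj.
by rewrite (@row_mxEr R 1 1 n).
Qed.

Lemma measurable_consrV n : measurable_fun setT (@consrV n).
Proof.
apply: measurable_fun_rV => i; case: (unliftP ord0 i) => [j ->|->].
  under eq_fun do rewrite consrVS.
  apply: (measurableT_comp (measurable_rV_coord j)).
  exact: measurable_fst.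
under eq_fun do rewrite consrV0.
exact: measurable_snd.
Qed.


(* the product of mu with the Lebesgue measure of R, carried to R^n.+1 *)
Definition consrV_measure n (mu : {measure set 'rV[R]_n -> \bar R}) :=
  pushforward (mu \x (@lebesgue_measure R))%E (@consrV n).

HB.instance Definition _ n (mu : {measure set 'rV[R]_n -> \bar R}) :=
  Measure.copy (consrV_measure mu)
    (measure_function_pushforward__canonical__measure_function_Measure
       (mu \x (@lebesgue_measure R))%E (@measurable_consrV n)).

(* n-dimensional Lebesgue measure, as an n-fold product; see lebesgue_rV_box *)
Fixpoint lebesgue_rV n : {measure set 'rV[R]_n -> \bar R} :=
  match n with
  | 0 => dirac (0 : 'rV[R]_0)
  | m.+1 => consrV_measure (lebesgue_rV m)
  end.

Lemma measurable_rV_box n (A : 'I_n -> set R) :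
  (forall i, measurable (A i)) ->
  measurable [set v : 'rV[R]_n | forall i, A i (v ord0 i)].
Proof.
move=> mA; rewrite (_ : mkset _ =
    \big[setI/setT]_(i < n) ((fun v : 'rV[R]_n => v ord0 i) @^-1` A i)).
  apply: bigsetI_measurable => i _.
  by rewrite -[X in measurable X]setTI; exact: measurable_rV_coord.
rewrite -bigcap_seq; apply/seteqP; split=> [v Av i _ //|v + i].
by apply; rewrite /= mem_index_enum.
Qed.

Lemma lebesgue_rV_box n (A : 'I_n -> set R) : (forall i, measurable (A i)) ->
  lebesgue_rV n [set v : 'rV[R]_n | forall i, A i (v ord0 i)] =
  (\prod_(i < n) lebesgue_measure (A i))%E.
Proof.
elim: n A => [|n IHn] A mA /=.
  by rewrite big_ord0 diracE mem_set// => -[].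
rewrite big_ord_recl muleC -(IHn (fun i => A (lift ord0 i)))//.
rewrite -product_measure1E; [|exact: (measurable_rV_box (fun i => mA (lift ord0 i)))|exact: mA].
congr (product_measure1 _ _ _); apply/seteqP; split=> -[v x] /=.
  move=> Avx; split; last by have := Avx ord0; rewrite consrV0.
  by move=> i; have := Avx (lift ord0 i); rewrite consrVS.
move=> [Av Ax] i; case: (unliftP ord0 i) => [j ->|->].
  by rewrite consrVS.
by rewrite consrV0.
Qed.

End lebesgue_rV.

Section euclidean.
Context (R : realType) (n : nat).
Implicit Types (x h : 'rV[R]_n) (V : 'M[R]_n) (E : set 'rV[R]_n).

Definition enorm x : R := Num.sqrt (\sum_(i < n) x ord0 i ^+ 2).

Definition eball x (r : R) : set 'rV[R]_n := [set y | enorm (y - x) < r].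

Definition maximal (f : 'rV[R]_n -> R) x : \bar R :=
  ereal_sup [set ((lebesgue_rV R n (eball x r))^-1 *
                  \int[lebesgue_rV R n]_(y in eball x r) `|f y|%:E)%E
            | r in [set r : R | 0 < r]].

(* A linear subspace of R^n is the row space of a square matrix V; its
   orthogonal complement is then the kernel of V^T. *)
Definition orthc V : 'M[R]_n := kermx V^T.

(* h^V and h^{V^perp} *)
Definition tpart V h : 'rV[R]_n := h *m proj_mx V (orthc V).
Definition npart V h : 'rV[R]_n := h *m proj_mx (orthc V) V.

Definition normal_ratio V h : \bar R :=
  if tpart V h == 0 then +oo%E else (enorm (npart V h) / enorm (tpart V h))%:E.

Definition tangential E : Prop :=
  forall x, E x -> exists V : 'M[R]_n, (\rank V).+1 = n /\
    forall h : nat -> 'rV[R]_n,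
      (forall i, h i != 0) -> (forall i, E (x + h i)) ->
      h @ \oo --> (0 : 'rV[R]_n) ->
      (fun i => normal_ratio V (h i)) @ \oo --> 0%E.

Definition sigma_tangential E : Prop :=
  exists F : nat -> set 'rV[R]_n,
    (forall k, tangential (F k)) /\ E `<=` \bigcup_k F k.

Lemma orthcP V h : (h <= orthc V)%MS <->
  forall v : 'rV[R]_n, (v <= V)%MS -> \sum_(i < n) h ord0 i * v ord0 i = 0.
Proof.
have dotE (u v : 'rV[R]_n) :
    \sum_(i < n) u ord0 i * v ord0 i = (u *m v^T) 0 0.
  by rewrite mxE; apply: eq_bigr => i _; rewrite mxE.
split=> [/sub_kermxP hV v /submxP[a ->]|hV].
  by rewrite dotE trmx_mul mulmxA hV mul0mx mxE.
apply/sub_kermxP/rowP => j; rewrite [RHS]mxE.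
have := hV _ (row_sub j V); rewrite dotE => <-.
by rewrite !mxE; apply: eq_bigr => i _; rewrite !mxE.
Qed.

Lemma tnpartP V h : [/\ (tpart V h <= V)%MS, (npart V h <= orthc V)%MS &
  tpart V h + npart V h = h].
Proof.
have VI0 : (V :&: orthc V = 0)%MS.
  apply/eqP; rewrite -submx0; apply/rV_subP => v.
  rewrite sub_capmx => /andP[vV /orthcP/(_ v vV)/eqP].
  rewrite psumr_eq0; last by move=> i _; rewrite -expr2 sqr_ge0.
  move=> /allP v0; rewrite submx0; apply/eqP/rowP => i; rewrite mxE.
  by have := v0 i (mem_index_enum _); rewrite -expr2 sqrf_eq0 => /eqP.
split; [exact: proj_mx_sub|exact: proj_mx_sub|].
rewrite /tpart /npart add_proj_mx//.
have /eqP dimV : \rank (V + orthc V)%MS == n.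
  have := mxrank_sum_cap V (orthc V); rewrite VI0 mxrank0 addn0 => ->.
  by rewrite mxrank_ker mxrank_tr subnKC// rank_leq_col.
by rewrite submx_full// /row_full dimV.
Qed.

End euclidean.

(* Main.v *)
(* Write u = |f|, A(x, r) for the average of u over the Euclidean ball B(x, r),
   and g = Mf = sup_r A(x, r). Comparing balls shows that g is finite and
   continuous, and that at each y either g(y) = u(y), or g(y) = A(y, r) for some
   r > 0, or averages over balls of radius tending to infinity come close to
   g(y), in which case g is minimal at y.

   Since u is uniformly continuous on bounded sets and the symmetric difference
   of B(x, r) and B(x + h, r) has measure O(|h|), the increments A(x + h, r) -
   A(x, r) are almost additive in h. Hence A(., r) is differentiable, with a
   modulus uniform for bounded x and for r in a compact subset of (0, oo), and a
   radius r > 0 with A(x, r) = g(x) yields a subgradient of g at x with that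
   modulus, as does the case of infinite radius with the subgradient 0.

   Subgradients with a fixed modulus have a closed graph. Where they are not
   unique, the points can be sorted by the dimension spanned by the differences
   of subgradients, which gives countably many tangential sets. Where they are
   unique, g has a first-order expansion along the points admitting such a
   subgradient. The points where g = u and u is differentiable are handled
   separately: if the gradient of u differs from the subgradient of g, contact
   points approach tangentially; otherwise averages over small balls obey the
   expansion of u. Finally |f| is not differentiable where f = 0 and Df is
   nonzero, which is again a tangential set. *)

Require Import Defs.
From HB Require Import structures.
From mathcomp Require Import all_boot all_order all_algebra.
From mathcomp Require Import all_classical all_reals all_analysis.
From mathcomp Require Import measurable_realfun.
From mathcomp Require Import ring lra.
Set Implicit Arguments.
Unset Strict Implicit.
Unset Printing Implicit Defensive.
Import Order.TTheory GRing.Theory Num.Theory.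
Import numFieldNormedType.Exports.
Local Open Scope classical_set_scope.
Local Open Scope ring_scope.

(** * Norms *)

Section matrix_norm.
Context (R : realType) (m n : nat).
Implicit Types (M : 'M[R]_(m, n)).

Lemma mx_coord_le_norm M i j : `|M i j| <= `|M|.
Proof.
by rewrite [leRHS]/Num.norm/= mx_normrE; apply: (le_bigmax _ (fun ij => `|M ij.1 ij.2|) (i, j)).
Qed.

Lemma mx_norm_le M c : 0 <= c -> (forall i j, `|M i j| <= c) -> `|M| <= c.
Proof.
by move=> c0 Mc; rewrite [leLHS]/Num.norm/= mx_normrE; apply/bigmax_leP; split=> // -[i j] _ /=.
Qed.

End matrix_norm.

Lemma closed_norm_le (R : realType) (V : normedModType R) (C : R) : closed [set x : V | `|x| <= C].
Proof.
apply: (@closed_comp _ _ (fun x : V => `|x|) [set t | t <= C]); last exact: closed_le.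
by move=> x _; exact: norm_continuous.
Qed.

Lemma nonexpansive_continuous (R : realType) (V W : normedModType R) (f : V -> W) (K : R) :
  (forall x y, `|f x - f y| <= K * `|x - y|) -> continuous f.
Proof.
move=> fK x; apply/cvgrPdist_lt => e e0.
have K1 : 0 < `|K| + 1 by rewrite ltr_wpDl.
near=> y; apply: le_lt_trans (fK _ _) _.
apply: (@le_lt_trans _ _ ((`|K| + 1) * `|x - y|)).
  by rewrite ler_wpM2r// (le_trans (ler_norm _))// lerDl.
rewrite -ltr_pdivlMl//; near: y; apply: cvgr_dist_lt; [exact: cvg_id|by rewrite mulr_gt0// invr_gt0].
Unshelve. all: by end_near. Qed.

(** Known for row vectors and carried over by [vec_mx], which does not increase the sup norm. The
    matrix form serves for tuples of subgradients stored as rows. *)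
Lemma mx_bounded_compact (R : realType) m n (C : R) : compact [set M : 'M[R]_(m, n) | `|M| <= C].
Proof.
have cpt : compact [set v : 'rV[R]_(m * n) | `|v| <= C].
  apply: bounded_closed_compact; last exact: closed_norm_le.
  by exists C; split; [exact: num_real|move=> M CM v /= vC; apply: le_trans vC (ltW CM)].
have -> : [set M : 'M[R]_(m, n) | `|M| <= C] = @vec_mx R m n @` [set v : 'rV[R]_(m * n) | `|v| <= C].
  apply/seteqP; split=> [M MC|_ [v vC <-]].
    exists (mxvec M); last exact: mxvecK.
    apply: mx_norm_le => [|i j]; first exact: le_trans (normr_ge0 _) MC.
    by rewrite ord1; case/mxvec_indexP: j => i' j; rewrite mxvecE (le_trans (mx_coord_le_norm _ _ _)).
  apply: mx_norm_le => [|i j]; first exact: le_trans (normr_ge0 _) vC.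
  by rewrite mxE (le_trans (mx_coord_le_norm _ _ _)).
apply: continuous_compact => //; apply: continuous_subspaceT.
apply: (@nonexpansive_continuous _ _ _ _ 1) => v w; rewrite mul1r -linearB.
by apply: mx_norm_le => // i j; rewrite mxE mx_coord_le_norm.
Qed.

Section euclidean_norm.
Context (R : realType) (n : nat).
Implicit Types (x y : 'rV[R]_n).

Lemma enorm_ge0 x : 0 <= enorm x.
Proof. exact: sqrtr_ge0. Qed.

Lemma enorm_sqr x : enorm x ^+ 2 = \sum_(i < n) x ord0 i ^+ 2.
Proof. by rewrite sqr_sqrtr// sumr_ge0// => i _; rewrite sqr_ge0. Qed.

Lemma enorm0 : enorm (0 : 'rV[R]_n) = 0.
Proof. by rewrite /enorm big1 ?sqrtr0// => i _; rewrite mxE expr0n. Qed.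

Lemma norm_le_enorm x : `|x| <= enorm x.
Proof.
apply: mx_norm_le (enorm_ge0 x) _ => i j; rewrite (ord1 i) {i}.
rewrite -(@ler_pXn2r _ 2) ?nnegrE ?enorm_ge0// enorm_sqr real_normK ?num_real//.
by rewrite (bigD1 j)//= lerDl sumr_ge0// => k _; rewrite sqr_ge0.
Qed.

Lemma enorm_le_norm x : enorm x <= n%:R * `|x|.
Proof.
rewrite -(@ler_pXn2r _ 2) ?nnegrE ?enorm_ge0 ?mulr_ge0// enorm_sqr exprMn.
apply: (@le_trans _ _ (n%:R * `|x| ^+ 2)).
  rewrite [leRHS]mulr_natl -[X in _ *+ X]card_ord -sumr_const; apply: ler_sum => i _.
  by rewrite -(@real_normK _ (x _ _)) ?num_real// ler_pXn2r ?nnegrE// mx_coord_le_norm.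
rewrite ler_wpM2r ?sqr_ge0//; case: (n) => [|k]; first by rewrite expr0n.
by rewrite -natrX ler_nat -mulnn leq_pmulr.
Qed.

Lemma enorm_eq0 x : (enorm x == 0) = (x == 0).
Proof.
apply/eqP/eqP => [x0|->]; last exact: enorm0.
by apply/eqP; rewrite -normr_eq0 eq_le normr_ge0 andbT -x0 norm_le_enorm.
Qed.

Lemma enormZ (a : R) x : enorm (a *: x) = `|a| * enorm x.
Proof.
rewrite /enorm -sqrtr_sqr -sqrtrM ?sqr_ge0// mulr_sumr; congr Num.sqrt.
by apply: eq_bigr => i _; rewrite mxE exprMn.
Qed.

Lemma enormN x : enorm (- x) = enorm x.
Proof. by rewrite -scaleN1r enormZ normrN1 mul1r. Qed.

Lemma cauchy_schwarz x y : \sum_(i < n) x ord0 i * y ord0 i <= enorm x * enorm y.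
Proof.
have [x0|x0] := eqVneq (enorm x) 0.
  rewrite x0 mul0r big1// => i _.
  by move/eqP: x0; rewrite enorm_eq0 => /eqP ->; rewrite mxE mul0r.
have [y0|y0] := eqVneq (enorm y) 0.
  rewrite y0 mulr0 big1// => i _.
  by move/eqP: y0; rewrite enorm_eq0 => /eqP ->; rewrite mxE mulr0.
have xy0 : 0 < enorm x * enorm y by rewrite mulr_gt0// lt_def ?x0 ?y0 enorm_ge0.
(* Expanding this square and dividing by twice the product of the norms gives the inequality. *)
have : 0 <= \sum_(i < n) (enorm y * x ord0 i - enorm x * y ord0 i) ^+ 2.
  by apply: sumr_ge0 => i _; rewrite sqr_ge0.
have -> : \sum_(i < n) (enorm y * x ord0 i - enorm x * y ord0 i) ^+ 2 =
    enorm y ^+ 2 * enorm x ^+ 2 - (enorm x * enorm y) * (\sum_(i < n) x ord0 i * y ord0 i) *+ 2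
    + enorm x ^+ 2 * enorm y ^+ 2.
  rewrite (enorm_sqr y) (enorm_sqr x) -{1}(enorm_sqr y) -{2}(enorm_sqr x) !mulr_sumr -sumrMnl -sumrB -big_split/=.
  by apply: eq_bigr => i _; ring.
move=> H; rewrite -(ler_pM2l xy0); move: H; set S := \sum_(i < n) _; rewrite mulr2n; nra.
Qed.

Lemma ler_enormD x y : enorm (x + y) <= enorm x + enorm y.
Proof.
rewrite -(@ler_pXn2r _ 2) ?nnegrE ?addr_ge0 ?enorm_ge0// enorm_sqr sqrrD !enorm_sqr.
have -> : \sum_(i < n) (x + y) ord0 i ^+ 2 = \sum_(i < n) x ord0 i ^+ 2 +
  (\sum_(i < n) x ord0 i * y ord0 i) *+ 2 + \sum_(i < n) y ord0 i ^+ 2.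
  by rewrite -sumrMnl -!big_split/=; apply: eq_bigr => i _; rewrite mxE sqrrD.
by rewrite lerD2r lerD2l lerMn2r cauchy_schwarz.
Qed.

Lemma eball_subset x y r s : enorm (x - y) + r <= s -> eball x r `<=` eball y s.
Proof.
move=> xyrs z; rewrite /eball/= => zx; apply: lt_le_trans xyrs.
rewrite -(subrKA x); apply: le_lt_trans (ler_enormD _ _) _.
by rewrite addrC ltrD2l.
Qed.

End euclidean_norm.

Lemma exists_natSinv_lt (R : realType) (e : R) : 0 < e -> exists k : nat, k.+1%:R^-1 < e.
Proof.
move=> e0; have [k _ ke] := near_infty_natSinv_lt (PosNum e0).
by exists k; apply: ke => /=.
Qed.

(** * Lebesgue measure of Euclidean balls *)

Section borel_rV.
Context (R : realType) (n : nat).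

(** The sigma-algebra is the product one, so an open set is exhibited as the union of the countably
    many rational boxes inside it. *)
Lemma open_measurable_rV (U : set 'rV[R]_n) : open U -> measurable U.
Proof.
move=> oU.
pose box (p : 'rV[rat]_n * nat) : set 'rV[R]_n :=
  [set v | forall i, `]ratr (p.1 ord0 i) - p.2.+1%:R^-1, ratr (p.1 ord0 i) + p.2.+1%:R^-1[%classic (v ord0 i)].
have -> : U = \bigcup_p (if `[< box p `<=` U >] then box p else set0).
  apply/seteqP; split=> [x Ux|x [p _]]; last by case: asboolP => // pU; exact: pU.
  have [e /= e0 xeU] := (nbhs_ballP x U).1 (open_nbhs_nbhs (conj oU Ux)).
  (* Half of [e], since the rational centre of the box is itself up to 1/(k+1) away from [x] in each
     coordinate. *)
  have [k ke] := exists_natSinv_lt (divr_gt0 e0 (ltr0n _ 2)).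
  have k0 : 0 < k.+1%:R^-1 :> R by rewrite invr_gt0.
  have H i : exists q, ratr q \in `]x ord0 i - k.+1%:R^-1, x ord0 i + k.+1%:R^-1[.
    apply: rat_in_itvoo; move: (x ord0 i) (k.+1%:R^-1) k0 => a b b0; lra.
  exists (\row_i (sval (cid (H i))), k) => //=; rewrite asboolT /=; last first.
    move=> y /= yb; apply: xeU.
    rewrite -ball_normE/=.
    apply: le_lt_trans (_ : k.+1%:R^-1 *+ 2 < _); last by rewrite mulr2n; move: (k.+1%:R^-1) ke => t; lra.
    apply: mx_norm_le => [|j i]; [by rewrite mulrn_wge0// ltW|rewrite (ord1 j) {j}].
    have := yb i; rewrite !mxE; case: cid => q /=; rewrite !in_itv/= mulr2n ler_norml.
    move: (x ord0 i) (k.+1%:R^-1) (ratr q) (y ord0 i) => a b c d; lra.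
  move=> i /=; rewrite mxE; case: cid => q /=; rewrite !in_itv/=; move: (x ord0 i) (k.+1%:R^-1) (ratr q) => a b c; lra.
apply: countable_bigcupT_measurable => // p; case: asboolP => // _.
exact: (@measurable_rV_box _ _ (fun i => `]ratr (p.1 ord0 i) - p.2.+1%:R^-1, ratr (p.1 ord0 i) + p.2.+1%:R^-1[%classic)).
Qed.

Lemma continuous_measurable_rV (f : 'rV[R]_n -> R) : continuous f -> measurable_fun setT f.
Proof.
move=> cf; apply: (measurability _ (measurable_realfun.RGenOpens.measurableE R)).
move=> _ [_ [a [b ->]] <-]; rewrite setTI; apply: open_measurable_rV.
by move/continuousP : cf; apply; exact: interval_open.
Qed.

Lemma eball_open (x : 'rV[R]_n) r : open (eball x r).
Proof.
rewrite openE => y /= yx; apply/nbhs_ballP.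
have d0 : 0 < (r - enorm (y - x)) / n.+1%:R by rewrite divr_gt0// subr_gt0.
exists ((r - enorm (y - x)) / n.+1%:R) => // z; rewrite -ball_normE/= => yz /=.
rewrite /eball/= (_ : z - x = (z - y) + (y - x)); last by rewrite subrKA.
apply: le_lt_trans (ler_enormD _ _) _.
rewrite -ltrBrDr -opprB enormN; apply: le_lt_trans (enorm_le_norm _) _.
move: yz; rewrite ltr_pdivlMr// mulrC; apply: le_lt_trans.
by rewrite ler_wpM2r// ler_nat.
Qed.

Lemma measurable_eball (x : 'rV[R]_n) r : measurable (eball x r).
Proof. by apply: open_measurable_rV; exact: eball_open. Qed.

End borel_rV.

Section affine_lebesgue.
Context (R : realType).
Local Notation mu := (lebesgue_rV R).

Definition affine_rV n (s : R) (a y : 'rV[R]_n) : 'rV[R]_n := a + s *: y.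

Lemma measurable_affine1 (s a : R) :
  measurable_fun [set: measurableTypeR R] (fun t : measurableTypeR R => a + s * t : measurableTypeR R).
Proof.
apply: continuous_measurable_fun => y.
apply: continuousD; first exact: cst_continuous.
by apply: continuousM; [exact: cst_continuous|exact: cvg_id].
Qed.

Lemma measurable_affine_rV n s (a : 'rV[R]_n) : measurable_fun setT (affine_rV s a).
Proof.
apply: measurable_fun_rV => i.
have -> : (fun x => affine_rV s a x ord0 i) = (fun x => a ord0 i + s * x ord0 i).
  by apply/funext => x; rewrite !mxE.
exact: (measurableT_comp (measurable_affine1 s (a ord0 i)) (measurable_rV_coord i)).
Qed.

(** The rescaled pushforward agrees with Lebesgue measure on half-open intervals, which determine
    it. For negative [s] the preimage is half-open on the other side. *)
Lemma lebesgue_affine1 (s a : R) (A : set R) : s != 0 -> measurable A ->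
  (@lebesgue_measure R ((fun t => a + s * t)%R @^-1` A) = `|s|^-1%:E * lebesgue_measure A)%E.
Proof.
move=> s0 mA.
have s1 : 0 < `|s| by rewrite normr_gt0.
pose P := measure_function_pushforward__canonical__measure_function_Measure (@lebesgue_measure R) (measurable_affine1 s a).
have H : lebesgue_measure A = (`|s|%:E * lebesgue_measure ((fun t => a + s * t)%R @^-1` A))%E.
  apply: (@lebesgue_measure_unique R (mscale (NngNum (ltW s1)) P)) => // _ [[b c]] _ <- /=.
  rewrite /mscale/= /pushforward lebesgue_measure_itv/= lte_fin.
  have [sp|sn] : 0 < s \/ s < 0 by apply/orP; move: s0; rewrite neq_lt orbC.
    have -> : (fun t => a + s * t) @^-1` `]b, c] = `](b - a) / s, (c - a) / s]%classic.
      by apply/seteqP; split=> t /=; rewrite !in_itv/= ltr_pdivrMr// ler_pdivlMr// => /andP[? ?]; apply/andP; split; lra.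
    rewrite lebesgue_measure_itv/= lte_fin ltr_pM2r ?invr_gt0// ltrD2r.
    case: ifPn => _; last by rewrite mule0.
    by rewrite -!EFinB -EFinM gtr0_norm//; congr (_%:E); field; rewrite gt_eqF.
  have -> : (fun t => a + s * t) @^-1` `]b, c] = `[(c - a) / s, (b - a) / s[%classic.
    by apply/seteqP; split=> t /=; rewrite !in_itv/= ltr_ndivlMr// ler_ndivrMr// => /andP[? ?]; apply/andP; split; lra.
  rewrite lebesgue_measure_itv/= lte_fin ltr_nM2r ?invr_lt0// ltrD2r.
  case: ifPn => _; last by rewrite mule0.
  by rewrite -!EFinB -EFinM ltr0_norm//; congr (_%:E); field; rewrite lt_eqF.
by rewrite H muleA -EFinM mulVf ?mul1e// gt_eqF.
Qed.

(** Induction on the dimension: sections in the first coordinate scale by the one-dimensional case,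
    and the induction hypothesis changes variables in the remaining coordinates. *)
Lemma lebesgue_affine_rV n (s : R) (a : 'rV[R]_n) (A : set 'rV[R]_n) : s != 0 -> measurable A ->
  (mu n (affine_rV s a @^-1` A) = (`|s| ^- n)%:E * mu n A)%E.
Proof.
move=> s0; elim: n a A => [|n IHn] a A mA.
  rewrite expr0 invr1 mul1e; congr (mu 0 _); apply/seteqP; split=> v /=;
  by rewrite (_ : affine_rV s a v = v)//; apply/rowP => -[].
pose a' : 'rV[R]_n := \row_i a ord0 (lift ord0 i).
pose F y : \bar R := @lebesgue_measure R (xsection (@consrV R n @^-1` A) y).
have mcA : measurable (@consrV R n @^-1` A).
  by rewrite -[X in measurable X]setTI; exact: measurable_consrV.
have mF : measurable_fun [set: 'rV[R]_n] (F : 'rV[R]_n -> \bar R) by exact: (measurable_fun_xsection (@lebesgue_measure R)).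
have F0 y : (0 <= F y)%E by exact: measure_ge0.
rewrite [LHS]/= /consrV_measure/= /pushforward /product_measure1.
transitivity (\int[mu n]_y (`|s|^-1%:E * F (affine_rV s a' y)))%E.
  apply: eq_integral => y _ /=.
  rewrite /F -(lebesgue_affine1 (a ord0 ord0))//; last exact: measurable_xsection.
  congr lebesgue_measure; apply/seteqP; split=> t; rewrite /xsection/= !inE/=;
  rewrite (_ : affine_rV s a _ = consrV (affine_rV s a' y, a ord0 ord0 + s * t))//;
  apply/rowP => i; rewrite [LHS]mxE [X in _ + X]mxE; case: (unliftP ord0 i) => [j ->|->];
  rewrite ?(consrVS, consrV0)//= [RHS]mxE [X in _ = X + _]mxE;
  by rewrite [X in _ = _ + X]mxE.
rewrite ge0_integralZl//; last exact: (measurableT_comp mF (measurable_affine_rV s a')).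
pose P := measure_function_pushforward__canonical__measure_function_Measure (mu n) (measurable_affine_rV s a').
rewrite [X in (_ * X)%E](_ : _ = \int[P]_y F y)%E; last first.
  by rewrite [RHS](ge0_integral_pushforward (measurable_affine_rV s a') (mu n)).
have sn0 : (0 <= `|s| ^- n) by rewrite invr_ge0 exprn_ge0.
rewrite (eq_measure_integral (mscale (NngNum sn0) (mu n))); last first.
  by move=> B mB _; rewrite /= /pushforward IHn.
by rewrite ge0_integral_mscale//= exprS invfM EFinM muleA.
Qed.

Lemma affine_eball n (s : R) (a x : 'rV[R]_n) r : s != 0 ->
  affine_rV s a @^-1` (eball (a + s *: x) (`|s| * r)) = eball x r.
Proof.
move=> s0; apply/seteqP; split=> y; rewrite /affine_rV /eball/=;
by rewrite opprD addrACA subrr add0r -scalerBr enormZ ltr_pM2l ?normr_gt0.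
Qed.

Lemma lebesgue_eball n (x : 'rV[R]_n) r : 0 < r ->
  (mu n (eball x r) = (r ^+ n)%:E * mu n (eball 0 1))%E.
Proof.
move=> r0; have rn0 : r != 0 by rewrite gt_eqF.
have := lebesgue_affine_rV x rn0 (measurable_eball (x + r *: 0) (`|r| * 1)).
rewrite affine_eball// scaler0 addr0 mulr1 gtr0_norm// => ->.
by rewrite muleA -EFinM divff ?mul1e// expf_eq0 (negbTE rn0) andbF.
Qed.

Lemma lebesgue_eball1_fin n : mu n (eball 0 1) \is a fin_num.
Proof.
rewrite ge0_fin_numE//.
pose B := [set v : 'rV[R]_n | forall i : 'I_n, `]-1 - 1, 1]%classic (v ord0 i)].
apply: (@le_lt_trans _ _ (mu n B)).
  apply: le_measure; rewrite ?inE; [exact: measurable_eball|exact: (@measurable_rV_box _ _ (fun=> `]-1 - 1, 1]%classic))|].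
  move=> v; rewrite /eball/= subr0 => v1 i.
  rewrite /= in_itv/=; have := le_lt_trans (le_trans (mx_coord_le_norm v ord0 i) (norm_le_enorm v)) v1.
  rewrite ltr_norml => /andP[? ?]; apply/andP; split; lra.
rewrite (@lebesgue_rV_box _ _ (fun=> `]-1 - 1, 1]%classic))//.
have -> : lebesgue_measure `]-1 - 1 : R, 1] = (1 - (-1 - 1))%:E.
  by rewrite lebesgue_measure_itv/= lte_fin ifT ?EFinB//; lra.
by rewrite prodEFin ltry.
Qed.

Lemma lebesgue_eball1_gt0 n : (0 < mu n (eball (0 : 'rV[R]_n) 1))%E.
Proof.
(* The cube of half-side 1/(n+1) lies in the unit ball because the Euclidean norm is at most n times
   the sup norm. *)
pose e : R := n.+1%:R^-1.
have e0 : 0 < e by rewrite invr_gt0.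
pose B := [set v : 'rV[R]_n | forall i : 'I_n, `]-e, e]%classic (v ord0 i)].
apply: (@lt_le_trans _ _ (mu n B)).
  rewrite (@lebesgue_rV_box _ _ (fun=> `]-e, e]%classic))//.
  under eq_bigr do rewrite lebesgue_measure_itv/= lte_fin ifT ?gt0_cp// -EFinB opprK.
  rewrite prodEFin lte_fin prodr_gt0// => i _; lra.
apply: le_measure; rewrite ?inE; [exact: (@measurable_rV_box _ _ (fun=> `]-e, e]%classic))|exact: measurable_eball|].
move=> v ve; rewrite /eball/= subr0; apply: le_lt_trans (enorm_le_norm v) _.
apply: (@le_lt_trans _ _ (n%:R * e)).
  rewrite ler_wpM2l//; apply: mx_norm_le => [|j i]; [exact: ltW|rewrite (ord1 j)].
  by have := ve i; rewrite /= in_itv/= ler_norml => /andP[/ltW -> ->].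
by rewrite /e ltr_pdivrMr// mul1r ltr_nat.
Qed.

End affine_lebesgue.

(** * Averages over balls *)

Section average.
Context (R : realType) (n : nat).
Local Notation mu := (lebesgue_rV R n).
Implicit Types (w : 'rV[R]_n -> R) (x y : 'rV[R]_n) (r s : R).

(** Real-valued and for [w] of any sign, so that averages can be subtracted; [maximalE] links it to
    [maximal]. *)
Definition avg w x r : R := (fine (mu (eball x r)))^-1 * \int[mu]_(y in eball x r) w y.

Lemma lebesgue_eball_fin x r : mu (eball x r) \is a fin_num.
Proof.
have [r0|r0] := ltP 0 r.
  by rewrite lebesgue_eball// fin_numM// lebesgue_eball1_fin.
rewrite (_ : eball x r = set0) ?measure0//.
by apply/seteqP; split=> // y; rewrite /eball/= ltNge (le_trans r0)// enorm_ge0.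
Qed.

Lemma continuous_bounded_eball w x r : continuous w ->
  exists2 M : R, 0 <= M & forall y, eball x r y -> `|w y| <= M.
Proof.
move=> cw; have /compact_bounded[M [Mr MH]] : compact (w @` [set y : 'rV[R]_n | `|y| <= `|x| + r]).
  by apply: continuous_compact; [exact: continuous_subspaceT|exact: mx_bounded_compact].
exists (`|M| + 1); first by rewrite addr_ge0.
move=> y yx; apply: (MH (`|M| + 1)); first by rewrite ltr_pwDr// ler_norm.
exists y => //=; rewrite -(subrK x y) addrC; apply: le_trans (ler_normD _ _) _; rewrite lerD2l.
exact: le_trans (norm_le_enorm _) (ltW yx).
Qed.

Lemma integrable_eball w x r : continuous w -> mu.-integrable (eball x r) (EFin \o w).
Proof.
move=> cw; apply: measurable_bounded_integrable.
- exact: measurable_eball.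
- by rewrite -ge0_fin_numE ?lebesgue_eball_fin.
- by apply: measurable_funTS; exact: continuous_measurable_rV.
have [M _ wM] := continuous_bounded_eball x r cw.
exists M; split=> [|K MK y yx]; first exact: num_real.
by apply: le_trans (wM y yx) (ltW MK).
Qed.

Lemma lebesgue_eball_fine x r : 0 < r -> fine (mu (eball x r)) = r ^+ n * fine (mu (eball 0 1)).
Proof. by move=> r0; rewrite lebesgue_eball// fineM// lebesgue_eball1_fin. Qed.

Lemma lebesgue_eball1_fine_gt0 : 0 < fine (mu (eball 0 1)).
Proof. by rewrite fine_gt0// lebesgue_eball1_gt0 -ge0_fin_numE ?lebesgue_eball1_fin. Qed.

Lemma lebesgue_eball_fine_gt0 x r : 0 < r -> 0 < fine (mu (eball x r)).
Proof. by move=> r0; rewrite lebesgue_eball_fine// mulr_gt0 ?exprn_gt0 ?lebesgue_eball1_fine_gt0. Qed.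

(** The factor r^n turns the average into a multiple of the integral that is independent of the
    ball, so different radii can be compared. *)
Lemma avgE w x r : 0 < r ->
  r ^+ n * avg w x r = (fine (mu (eball 0 1)))^-1 * \int[mu]_(y in eball x r) w y.
Proof.
move=> r0; rewrite /avg lebesgue_eball_fine// invfM !mulrA divff ?mul1r//.
by rewrite expf_eq0 gt_eqF// andbF.
Qed.

Lemma maximalE f x : continuous f -> maximal f x =
  ereal_sup [set (avg (fun y => `|f y|) x r)%:E | r in [set r : R | 0 < r]].
Proof.
move=> cf; have cu : continuous (fun y => `|f y|).
  by move=> y; apply: continuous_comp; [exact: cf|exact: norm_continuous].
rewrite /maximal; congr ereal_sup; apply: eq_imagel => r /= r0.
rewrite /avg EFinM fineK; last first.
  by apply: integrable_fin_num; [exact: measurable_eball|exact: (integrable_eball _ _ cu)].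
rewrite -[X in (X^-1)%E](fineK (lebesgue_eball_fin x r)) inver gt_eqF//.
exact: lebesgue_eball_fine_gt0.
Qed.

Lemma avgD w1 w2 x r : continuous w1 -> continuous w2 ->
  avg (fun y => w1 y + w2 y) x r = avg w1 x r + avg w2 x r.
Proof. by move=> c1 c2; rewrite /avg RintegralD ?mulrDr//; [exact: measurable_eball|exact: integrable_eball..]. Qed.

Lemma avgZ w (c : R) x r : continuous w -> avg (fun y => c * w y) x r = c * avg w x r.
Proof. by move=> cw; rewrite /avg RintegralZl 1?mulrCA//; [exact: measurable_eball|exact: integrable_eball]. Qed.

Lemma avg_cst (c : R) x r : 0 < r -> avg (fun=> c) x r = c.
Proof.
move=> r0; rewrite /avg Rintegral_cst; last exact: measurable_eball.
by rewrite mulrCA mulVf ?mulr1// gt_eqF// lebesgue_eball_fine_gt0.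
Qed.

Lemma avg_le w1 w2 x r : 0 < r -> continuous w1 -> continuous w2 ->
  (forall y, eball x r y -> w1 y <= w2 y) -> avg w1 x r <= avg w2 x r.
Proof.
move=> r0 c1 c2 w12; rewrite ler_wpM2l ?invr_ge0 ?fine_ge0//; try exact: measure_ge0.
by apply: le_Rintegral => //; [exact: measurable_eball|exact: integrable_eball..].
Qed.

Lemma avg_nested w x y r s : 0 < r -> enorm (x - y) + r <= s -> continuous w ->
  (forall z, eball y s z -> 0 <= w z) -> r ^+ n * avg w x r <= s ^+ n * avg w y s.
Proof.
move=> r0 xys cw w0; have s0 : 0 < s by apply: lt_le_trans xys; rewrite ltr_wpDl// enorm_ge0.
rewrite !avgE// ler_wpM2l ?invr_ge0 ?fine_ge0//.
apply: fine_le; [by apply: integrable_fin_num; [exact: measurable_eball|exact: integrable_eball]..|].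
apply: ge0_subset_integral; [exact: measurable_eball|exact: measurable_eball| |by move=> z zs; rewrite lee_fin w0|exact: eball_subset].
by apply/measurable_EFinP; apply: measurable_funTS; exact: continuous_measurable_rV.
Qed.

(** Change of variables under a measure-preserving map; s = 1 gives translations and s = -1 point
    reflections. *)
Lemma avg_affine w (s : R) (a x : 'rV[R]_n) r : `|s| = 1 -> 0 < r -> continuous w ->
  avg w (affine_rV s a x) r = avg (w \o affine_rV s a) x r.
Proof.
move=> s1 r0 cw; have s0 : s != 0 by rewrite -normr_gt0 s1.
have E : affine_rV s a @^-1` (eball (affine_rV s a x) r) = eball x r.
  by rewrite -[RHS](affine_eball a _ _ s0) s1 mul1r.
apply: (@mulfI _ (r ^+ n)); first by rewrite expf_neq0 ?gt_eqF.
rewrite !avgE//; congr (_ * fine _).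
have ca : continuous (affine_rV s a).
  apply: (@nonexpansive_continuous _ _ _ _ 1) => u v.
  by rewrite /affine_rV opprD addrACA subrr add0r -scalerBr normrZ s1.
pose P := measure_function_pushforward__canonical__measure_function_Measure mu (measurable_affine_rV s a).
transitivity (\int[P]_(y in eball (affine_rV s a x) r) (w y)%:E)%E; last first.
  rewrite -E; apply: (@integral_pushforward _ _ _ _ _ _ (measurable_affine_rV s a) mu _ (EFin \o w)); rewrite ?E.
- by apply/measurable_EFinP; exact: continuous_measurable_rV.
- by apply: (@integrable_eball (w \o affine_rV s a)) => u; apply: continuous_comp; [exact: ca|exact: cw].
- exact: measurable_eball.
apply: (eq_measure_integral P) => A mA _.
by rewrite /= /pushforward lebesgue_affine_rV// s1 expr1n invr1 mul1e.
Qed.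

End average.

(** * Averages of affine functions, and dependence of averages on centre and radius *)

Section average_estimates.
Context (R : realType) (n : nat).
Implicit Types (w : 'rV[R]_n -> R) (x y h p : 'rV[R]_n) (r s : R).

Definition dot p h : R := \sum_(i < n) p ord0 i * h ord0 i.

Lemma dotDr p h1 h2 : dot p (h1 + h2) = dot p h1 + dot p h2.
Proof. by rewrite -big_split; apply: eq_bigr => i _; rewrite mxE mulrDr. Qed.

Lemma dotDl p1 p2 h : dot (p1 + p2) h = dot p1 h + dot p2 h.
Proof. by rewrite -big_split; apply: eq_bigr => i _; rewrite mxE mulrDl. Qed.

Lemma dotZr p a h : dot p (a *: h) = a * dot p h.
Proof. by rewrite mulr_sumr; apply: eq_bigr => i _; rewrite mxE mulrCA. Qed.

Lemma dotZl p a h : dot (a *: p) h = a * dot p h.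
Proof. by rewrite mulr_sumr; apply: eq_bigr => i _; rewrite mxE mulrA. Qed.

Lemma dotNr p h : dot p (- h) = - dot p h.
Proof. by rewrite -scaleN1r dotZr mulN1r. Qed.

Lemma dotNl p h : dot (- p) h = - dot p h.
Proof. by rewrite -scaleN1r dotZl mulN1r. Qed.

Lemma dotBl p1 p2 h : dot (p1 - p2) h = dot p1 h - dot p2 h.
Proof. by rewrite dotDl dotNl. Qed.

Lemma dotBr p h1 h2 : dot p (h1 - h2) = dot p h1 - dot p h2.
Proof. by rewrite dotDr dotNr. Qed.

Lemma dot0l h : dot 0 h = 0.
Proof. by rewrite -(scale0r 0) dotZl mul0r. Qed.

Lemma dot0r p : dot p 0 = 0.
Proof. by rewrite -(scale0r 0) dotZr mul0r. Qed.

Lemma dotxx p : dot p p = enorm p ^+ 2.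
Proof. by rewrite enorm_sqr. Qed.

Lemma dot_le p h : `|dot p h| <= enorm p * enorm h.
Proof.
rewrite ler_norml; apply/andP; split; last exact: cauchy_schwarz.
by rewrite lerNl -dotNl -(enormN p) cauchy_schwarz.
Qed.

Lemma dot_continuous p : continuous (dot p).
Proof.
apply: (@nonexpansive_continuous _ _ _ _ (enorm p * n%:R)) => x y.
rewrite -dotNr -dotDr; apply: le_trans (dot_le _ _) _.
by rewrite -mulrA ler_wpM2l ?enorm_ge0 ?enorm_le_norm.
Qed.

Lemma near_enorm x (e : R) : 0 < e -> \forall y \near x, enorm (y - x) < e.
Proof.
move=> e0; have : open_nbhs x (eball x e) by split; [exact: eball_open|rewrite /eball/= subrr enorm0].
exact: open_nbhs_nbhs.
Qed.

Lemma nbhs_enorm x (P : set 'rV[R]_n) : (\forall y \near x, P y) ->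
  exists2 e, 0 < e & forall y, enorm (y - x) < e -> P y.
Proof.
move=> /nbhs_ballP[e /= e0 xeP]; exists e => // y yx; apply: xeP.
by rewrite -ball_normE/= distrC (le_lt_trans (norm_le_enorm _)).
Qed.

Lemma avg_translate w k x r : 0 < r -> continuous w -> avg w (x + k) r = avg (fun y => w (y + k)) x r.
Proof.
move=> r0 cw; have := @avg_affine R n w 1 k x r (normr1 _) r0 cw.
have -> : affine_rV 1 k x = x + k by rewrite /affine_rV scale1r addrC.
by move->; congr avg; apply/funext => y; rewrite /= /affine_rV scale1r addrC.
Qed.

(** The reflection through [x] preserves the ball and changes the sign of the function. *)
Lemma avg_dot p x r : 0 < r -> avg (fun y => dot p (y - x)) x r = 0.
Proof.
move=> r0; have cw : continuous (fun y => dot p (y - x)).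
  apply: (@nonexpansive_continuous _ _ _ _ (enorm p * n%:R)) => y z.
  rewrite -dotNr -dotDr (_ : y - x - (z - x) = y - z); last by rewrite opprB addrA subrK.
  apply: le_trans (dot_le _ _) _.
  by rewrite -mulrA ler_wpM2l ?enorm_ge0 ?enorm_le_norm.
have := @avg_affine R n _ (-1) (x + x) x r (normrN1 _) r0 cw.
have -> : affine_rV (-1) (x + x) x = x by rewrite /affine_rV scaleN1r addrK.
have -> : (fun y => dot p (y - x)) \o affine_rV (-1) (x + x) = (fun y => (-1) * dot p (y - x)).
  apply/funext => y; rewrite /= /affine_rV scaleN1r -dotZr; congr dot.
  by rewrite scaleN1r opprB addrAC addrK.
rewrite avgZ//; lra.
Qed.

Lemma continuous_add w1 w2 : continuous w1 -> continuous w2 -> continuous (fun y => w1 y + w2 y).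
Proof. by move=> c1 c2 y; exact: cvgD (c1 y) (c2 y). Qed.

Lemma continuous_scale (c : R) w : continuous w -> continuous (fun y => c * w y).
Proof. by move=> cw y; exact: cvgM (cvg_cst _) (cw y). Qed.

(** Monotonicity of integrals over nested balls, applied to the nonnegative functions M + w and M -
    w. *)
Lemma avg_shell w x y r s (M : R) : 0 < r -> enorm (x - y) + r <= s -> continuous w ->
  (forall z, eball y s z -> `|w z| <= M) ->
  `|s ^+ n * avg w y s - r ^+ n * avg w x r| <= M * (s ^+ n - r ^+ n).
Proof.
move=> r0 xys cw wM; have s0 : 0 < s by apply: lt_le_trans xys; rewrite ltr_wpDl// enorm_ge0.
have cM : continuous (fun=> M : R) := @cst_continuous 'rV[R]_n R M.
have cMw := continuous_scale (c := -1) cw.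
have c1 : continuous (fun z => M + w z) by exact: continuous_add.
have c2 : continuous (fun z => M + (-1) * w z) by exact: continuous_add.
have /= := avg_nested r0 xys c1; have /= := avg_nested r0 xys c2.
rewrite !avgD// !avgZ// !avg_cst// => H2 H1; rewrite ler_norml; apply/andP; split.
  have {}H1 := H1 (ltac:(move=> z /wM; rewrite ler_norml; lra)); nra.
have {}H2 := H2 (ltac:(move=> z /wM; rewrite ler_norml; lra)); nra.
Qed.

(** With b = 3^k, multiplying 1 + b t by 1 + t adds t + b t^2 <= 2 b t, which closes the
    induction. *)
Lemma bernoulli3 (t : R) k : 0 <= t <= 1 -> (1 + t) ^+ k <= 1 + 3 ^+ k * t.
Proof.
move=> /andP[t0 t1]; elim: k => [|k IHk]; first by rewrite !expr0; lra.
rewrite !exprS; have : 1 <= 3 ^+ k :> R by rewrite exprn_ege1//; lra.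
move: IHk; set a := (1 + t) ^+ k; set b := 3 ^+ k => IHk b1.
have H : (1 + t) * a <= (1 + t) * (1 + b * t) by rewrite ler_wpM2l//; lra.
have H2 : b * t * t <= b * t by rewrite ler_piMr// mulr_ge0//; lra.
have H3 : t <= b * t by rewrite ler_peMl//; lra.
lra.
Qed.

Lemma exprDn_le3 r d k : 0 < r -> 0 <= d <= r -> (r + d) ^+ k <= r ^+ k * (1 + 3 ^+ k * (d / r)).
Proof.
move=> r0 /andP[d0 dr].
have -> : r + d = r * (1 + d / r) by rewrite mulrDr mulr1 mulrCA mulfV ?mulr1// gt_eqF.
rewrite exprMn ler_wpM2l ?exprn_ge0 ?(ltW r0)// bernoulli3//.
by rewrite divr_ge0 ?(ltW r0)//= ler_pdivrMr// mul1r.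
Qed.

Lemma ler_dist2 (a b c M D : R) : `|c - a| <= M * D -> `|c - b| <= M * D -> `|b - a| <= M * 2 * D.
Proof. rewrite !ler_norml; lra. Qed.

(** Both balls lie in B(x, r + |h|), and each misses a part of relative measure at most 3^n |h| /
    r. *)
Lemma avg_shift w x h r (M : R) : 0 < r -> enorm h <= r -> continuous w -> 
  (forall z, eball x (r + enorm h) z -> `|w z| <= M) ->
  `|avg w (x + h) r - avg w x r| <= M * 2 * 3 ^+ n * enorm h / r.
Proof.
move=> r0 hr cw wM.
have h0 := enorm_ge0 h.
have M0 : 0 <= M by apply: le_trans (wM x _); rewrite // /eball/= subrr enorm0; lra.
have H1 := @avg_shell w x x r (r + enorm h) M r0.
have H2 := @avg_shell w (x + h) x r (r + enorm h) M r0.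
have {}H1 := H1 _ cw wM; rewrite subrr enorm0 add0r lerDl in H1; have {}H1 := H1 h0.
have {}H2 := H2 _ cw wM; rewrite addrAC subrr add0r addrC lexx in H2; have {}H2 := H2 isT.
have rn0 : 0 < r ^+ n by rewrite exprn_gt0.
rewrite -(ler_pM2l rn0) -{1}(gtr0_norm rn0) -normrM mulrBr.
have B : (r + enorm h) ^+ n - r ^+ n <= r ^+ n * (3 ^+ n * (enorm h / r)).
  have := @exprDn_le3 r (enorm h) n r0; rewrite h0 hr => /(_ isT).
  by rewrite mulrDr mulr1 lerBlDl.
apply: (@le_trans _ _ (M * 2 * ((r + enorm h) ^+ n - r ^+ n))).
  exact: ler_dist2 H1 H2.
have -> : r ^+ n * (M * 2 * 3 ^+ n * enorm h / r) = M * 2 * (r ^+ n * (3 ^+ n * (enorm h / r))) by ring.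
by rewrite ler_wpM2l// mulr_ge0.
Qed.

Lemma avg_bounds w x r a b : 0 < r -> continuous w -> (forall y, eball x r y -> a <= w y <= b) ->
  a <= avg w x r <= b.
Proof.
move=> r0 cw wab; have cst (c : R) : continuous (fun=> c : R) := @cst_continuous 'rV[R]_n R c.
rewrite -{1}(avg_cst a x r0) -(avg_cst b x r0); apply/andP; split;
by apply: avg_le => // y /wab/andP[].
Qed.

Lemma avg_continuous_radius w x r : 0 < r -> continuous w -> {for r, continuous (avg w x)}.
Proof.
move=> r0 cw; have [M M0 wM] := continuous_bounded_eball x (r + r) cw.
have rn0 : r ^+ n != 0 by rewrite expf_neq0// gt_eqF.
have H (a b : R) : 0 < a -> a <= b -> b < r + r ->
    `|b ^+ n * avg w x b - a ^+ n * avg w x a| <= M * `|b ^+ n - a ^+ n|.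
  move=> a0 ab br; rewrite (ger0_norm (_ : 0 <= b ^+ n - a ^+ n)); last first.
    by rewrite subr_ge0 lerXn2r ?nnegrE//; [exact: ltW|exact: le_trans (ltW a0) ab].
  apply: avg_shell => //; first by rewrite subrr enorm0 add0r.
  by move=> z zb; apply: wM; apply: lt_le_trans zb (ltW br).
(* The shell estimate controls the normalised integral; the factor s^n is divided out afterwards. *)
have C : (fun s => s ^+ n * avg w x s) @ r --> r ^+ n * avg w x r.
  apply/cvgrPdist_le => e e0.
  have : (fun s => s ^+ n) @ r --> r ^+ n by exact: exprn_continuous.
  have M1 : 0 < M + 1 by rewrite ltr_wpDl.
  move=> /cvgrPdist_le /(_ (e / (M + 1)) (divr_gt0 e0 M1)) Cn.
  near=> s.
  have s0 : 0 < s by near: s; exact: lt_nbhsr.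
  have sr : s < r + r by near: s; apply: lt_nbhsl; rewrite ltrDl.
  have : `|r ^+ n - s ^+ n| <= e / (M + 1) by near: s.
  rewrite ler_pdivlMr// => D.
  apply: (@le_trans _ _ (M * `|r ^+ n - s ^+ n|)); last first.
    by apply: le_trans D; rewrite mulrC ler_wpM2l// lerDl.
  have [sler|rles] := leP s r; first by apply: H => //; rewrite ltrDl.
  by rewrite distrC (distrC (r ^+ n)); apply: H => //; exact: ltW.
have E : {near r, (fun s => s ^- n * (s ^+ n * avg w x s)) =1 avg w x}.
  near=> s; have s0 : 0 < s by near: s; exact: lt_nbhsr.
  by rewrite mulrA mulVf ?mul1r// expf_neq0// gt_eqF.
suff : (fun s => s ^- n * (s ^+ n * avg w x s)) @ r --> avg w x r.
  by apply: cvg_trans; apply: near_eq_cvg; apply: filterS E => s ->.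
rewrite (_ : avg w x r = r ^- n * (r ^+ n * avg w x r)); last by rewrite mulrA mulVf ?mul1r.
apply: cvgM => //; apply: cvgV => //; exact: exprn_continuous.
Unshelve. all: by end_near. Qed.

End average_estimates.

Lemma near_dist_continuous (R : realType) (V : normedModType R) (g : V -> R) :
  (forall x e, 0 < e -> \forall y \near x, `|g x - g y| <= e) -> continuous g.
Proof. by move=> H x; apply/cvgrPdist_le => e; exact: H. Qed.

(** * The maximal function *)

Section maximal_average.
Context (R : realType) (n : nat) (u g : 'rV[R]_n -> R).
Hypotheses (cu : continuous u) (u0 : forall x, 0 <= u x).
(** With [g_lub], this characterises [g] as a finite supremum of averages, keeping extended reals
    out of the analysis. *)
Hypothesis avg_le_g : forall x (r : R), 0 < r -> avg u x r <= g x.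
Hypothesis g_lub : forall x (c : R), (forall r : R, 0 < r -> avg u x r <= c) -> g x <= c.
Implicit Types (x y z h p : 'rV[R]_n) (r s e d : R).

Lemma avg_small_radius x e : 0 < e -> exists2 d : R, 0 < d &
  forall y r, enorm (y - x) < d -> 0 < r < d -> `|avg u y r - u x| <= e.
Proof.
move=> e0; have /cvgrPdist_le/(_ e e0)/nbhs_enorm[d d0 H] := @cu x.
exists (d / 2); first by rewrite divr_gt0.
move=> y r yx /andP[r0 rd].
have : u x - e <= avg u y r <= u x + e.
  apply: avg_bounds => // z zy.
  have : `|u x - u z| <= e.
    apply: H; rewrite (_ : z - x = (z - y) + (y - x)); last by rewrite subrKA.
    by apply: le_lt_trans (ler_enormD _ _) _; move: zy; rewrite /eball/=; lra.
  by rewrite ler_norml; move: (u x) (u z) => a b; lra.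
by rewrite ler_norml; move: (u x) (avg u y r) => a b; lra.
Qed.

Lemma le_maximal x : u x <= g x.
Proof.
apply/ler_addgt0Pr => e e0; have [d d0 H] := avg_small_radius x e0.
have d20 : 0 < d / 2 by rewrite divr_gt0.
have := H x (d / 2); rewrite subrr enorm0 => /(_ d0).
rewrite d20 ltr_pdivrMr// ltr_pMr// ltr1n => /(_ isT).
by have := avg_le_g x d20; rewrite ler_norml; lra.
Qed.

Lemma maximal_ge0 x : 0 <= g x.
Proof. exact: le_trans (u0 x) (le_maximal x). Qed.

(** B(x, r) lies in B(y, r + |x - y|) and u >= 0; the factor bounds the ratio of the two volumes. *)
Lemma avg_le_shift x y r : 0 < r -> enorm (x - y) <= r ->
  avg u x r <= (1 + 3 ^+ n * (enorm (x - y) / r)) * avg u y (r + enorm (x - y)).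
Proof.
move=> r0 dr; set d := enorm (x - y) in dr *.
have d0 : 0 <= d by exact: enorm_ge0.
have rn0 : 0 < r ^+ n by rewrite exprn_gt0.
have A0 : 0 <= avg u y (r + d).
  by have := @avg_le _ _ (fun=> 0) u y (r + d); rewrite avg_cst ?ltr_wpDr//; apply => //; exact: cst_continuous.
rewrite -(ler_pM2l rn0).
apply: le_trans (@avg_nested _ _ u x y r (r + d) r0 _ cu (fun z _ => u0 z)) _; last first.
  by rewrite [leRHS]mulrA ler_wpM2r// exprDn_le3// d0 dr.
by rewrite addrC.
Qed.

Lemma avg_le_maximal x y r : 0 < r -> enorm (x - y) <= r ->
  avg u x r <= (1 + 3 ^+ n * (enorm (x - y) / r)) * g y.
Proof.
move=> r0 dr; apply: le_trans (avg_le_shift r0 dr) _; rewrite ler_wpM2l//.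
  by rewrite addr_ge0// mulr_ge0 ?exprn_ge0// divr_ge0 ?enorm_ge0// ltW.
by apply: avg_le_g; rewrite ltr_wpDr// enorm_ge0.
Qed.

Lemma maximal_approx x e : 0 < e -> exists2 r : R, 0 < r & g x - e < avg u x r.
Proof.
move=> e0; apply/not_exists2P => H.
suff : g x <= g x - e by rewrite lerBrDr; lra.
by apply: g_lub => r r0; rewrite leNgt; apply/negP; case: (H r).
Qed.

(** Averages over small balls are close to u(x) <= g(x); for radii bounded below, recentring at [x]
    costs a multiple of |y - x|. *)
Lemma maximal_upper x e : 0 < e -> \forall y \near x, g y <= g x + e.
Proof.
move=> e0; have [d d0 H] := avg_small_radius x e0.
pose K := 2 / d * 3 ^+ n * (g x + 1).
have g0 := maximal_ge0 x.
have K0 : 0 < K by rewrite !mulr_gt0 ?invr_gt0 ?exprn_gt0//; lra.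
near=> y.
have yd : enorm (y - x) < d by near: y; exact: near_enorm.
have yd2 : enorm (y - x) < d / 2 by near: y; apply: near_enorm; rewrite divr_gt0.
have yK : enorm (y - x) < e / K by near: y; apply: near_enorm; rewrite divr_gt0.
apply: g_lub => r r0; have [rd|dr] := ltP r d.
  have := H y r yd; rewrite r0 rd => /(_ isT); rewrite ler_norml => /andP[_].
  by have := le_maximal x; lra.
have yr : enorm (y - x) <= r by lra.
apply: le_trans (avg_le_maximal r0 yr) _.
rewrite mulrDl mul1r lerD2l.
apply: (@le_trans _ _ (K * enorm (y - x))); last first.
  by move: yK; rewrite ltr_pdivlMr// mulrC => /ltW.
have H1 : enorm (y - x) / r <= 2 / d * enorm (y - x).
  rewrite mulrC ler_wpM2r ?enorm_ge0// -[2]invrK -invfM lef_pV2 ?posrE ?mulr_gt0//; lra.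
rewrite mulrC (_ : K * _ = (g x + 1) * (3 ^+ n * (2 / d * enorm (y - x)))); last by rewrite /K; ring.
apply: ler_pM => //; last by rewrite ler_wpM2l ?exprn_ge0.
- by rewrite mulr_ge0 ?exprn_ge0// divr_ge0 ?enorm_ge0// ltW.
- by rewrite lerDl.
Unshelve. all: by end_near. Qed.

(** A ball that nearly attains the supremum at [x] is recentred at [y]; [maximal_upper] bounds the
    factor g(y) in the error. *)
Lemma maximal_lower x e : 0 < e -> \forall y \near x, g x - e <= g y.
Proof.
move=> e0; have e20 : 0 < e / 2 by rewrite divr_gt0.
have [r r0 gr] := maximal_approx x e20.
pose K := 3 ^+ n / r * (g x + 1).
have g0 := maximal_ge0 x.
have K0 : 0 < K by rewrite !mulr_gt0 ?invr_gt0 ?exprn_gt0//; lra.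
near=> y.
have yr : enorm (x - y) <= r by rewrite -enormN opprB; near: y; apply: filterS (near_enorm x r0) => y /ltW.
have yK : enorm (y - x) < e / 2 / K by near: y; apply: near_enorm; rewrite divr_gt0.
have gy : g y <= g x + 1 by near: y; exact: maximal_upper.
have := avg_le_maximal r0 yr; rewrite mulrDl mul1r -enormN opprB.
have : 3 ^+ n * (enorm (y - x) / r) * g y <= K * enorm (y - x).
  rewrite (_ : K * _ = 3 ^+ n * (enorm (y - x) / r) * (g x + 1)); last by rewrite /K; ring.
  by rewrite ler_wpM2l// mulr_ge0 ?exprn_ge0// divr_ge0 ?enorm_ge0// ltW.
move: yK; rewrite ltr_pdivlMr// [_ * K]mulrC.
move: gr (K * _) (3 ^+ n * _ * _); clear; move: (avg _ _ _) => a gr b c; lra.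
Unshelve. all: by end_near. Qed.

Lemma maximal_continuous : continuous g.
Proof.
apply: near_dist_continuous => x e e0; near=> y.
have yu : g y <= g x + e by near: y; exact: maximal_upper.
have yl : g x - e <= g y by near: y; exact: maximal_lower.
by rewrite ler_norml; lra.
Unshelve. all: by end_near. Qed.

(* Either the supremum is attained, possibly as the limit r -> 0, or averages
   over balls of radius tending to infinity come close to it; these have a limit
   superior that does not depend on the centre, so that g is then minimal at y.
   *)
Lemma maximal_trichotomy y :
  [\/ u y = g y, exists2 r : R, 0 < r & avg u y r = g y | forall z, g y <= g z].
Proof.
have [ugy|ugy] := eqVneq (u y) (g y); first by constructor 1.
have [ming|] := pselect (forall z, g y <= g z); first by constructor 3.
move=> /existsNP[z /negP]; rewrite -ltNge => gzy; constructor 2.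
have uglt : u y < g y by rewrite lt_neqAle ugy le_maximal.
have [d d0 dH] : exists2 d : R, 0 < d & forall r, 0 < r < d -> avg u y r <= (u y + g y) / 2.
  have e0 : 0 < (g y - u y) / 2 by rewrite divr_gt0// subr_gt0.
  have [d d0 H] := avg_small_radius y e0; exists d => // r rd.
  have := H y r; rewrite subrr enorm0 => /(_ d0 rd).
  by move: (avg u y r) => a; rewrite ler_norml; lra.
(* Recentring a large ball at [z] bounds its average by g(z) + K / r, and beyond [D] the term K / r
   is at most half of g(y) - g(z). *)
have [D D0 DH] : exists2 D : R, 0 < D & forall r, D < r -> avg u y r <= (g z + g y) / 2.
  pose K := 3 ^+ n * enorm (y - z) * (g z + 1).
  have K0 : 0 <= K by rewrite !mulr_ge0 ?enorm_ge0 ?exprn_ge0// addr_ge0// maximal_ge0.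
  have gyz : 0 < (g y - g z) / 2 by rewrite divr_gt0// subr_gt0.
  exists (enorm (y - z) + K / ((g y - g z) / 2) + 1).
    by rewrite ltr_wpDl// addr_ge0 ?enorm_ge0// divr_ge0// ltW.
  move=> r rD.
  have KD : 0 <= K / ((g y - g z) / 2) by rewrite divr_ge0// ltW.
  have r0 : 0 < r by move: (enorm_ge0 (y - z)); lra.
  have yr : enorm (y - z) <= r by lra.
  apply: le_trans (avg_le_maximal r0 yr) _.
  have : 3 ^+ n * (enorm (y - z) / r) * g z <= K / r.
    rewrite (_ : K / r = 3 ^+ n * (enorm (y - z) / r) * (g z + 1)); last by rewrite /K; ring.
    rewrite ler_wpM2l ?lerDl// mulr_ge0 ?exprn_ge0// divr_ge0 ?enorm_ge0// ltW//.
  have : K / r <= (g y - g z) / 2.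
    rewrite ler_pdivrMr// -ler_pdivrMl// mulrC; move: (enorm_ge0 (y - z)); lra.
  rewrite [(1 + _) * _]mulrDl mul1r; move: (3 ^+ n * _ * _) (K / r) => a b; lra.
(* A level below g(y) but above both thresholds can only be exceeded at radii in [d, D]. This gives
   d <= D first, and later excludes a maximum over [d, D] below g(y). *)
have abs (c : R) : (u y + g y) / 2 <= c -> (g z + g y) / 2 <= c -> c < g y ->
    exists2 r : R, d <= r <= D & c < avg u y r.
  move=> uc zc cg; have e0 : 0 < g y - c by rewrite subr_gt0.
  have [r r0] := maximal_approx y e0; rewrite subKr => cr; exists r => //.
  apply/andP; split; rewrite leNgt; apply/negP => rr.
    by have := dH r; rewrite r0 rr => /(_ isT); lra.
  by have := DH r rr; lra.
have dD : d <= D.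
  have [|||r /andP[dr rD] _] := abs (Num.max ((u y + g y) / 2) ((g z + g y) / 2)).
  - by rewrite le_max lexx.
  - by rewrite le_max lexx orbT.
  - by rewrite gt_max; apply/andP; split; lra.
  - exact: le_trans dr rD.
have cA : {within `[d, D], continuous (avg u y)}.
  apply: continuous_in_subspaceT => r; rewrite inE/= in_itv/= => /andP[dr _].
  apply: avg_continuous_radius => //; exact: lt_le_trans dr.
have [c cdD cmax] := EVT_max dD cA.
have c0 : 0 < c by move: cdD; rewrite in_itv/= => /andP[dc _]; exact: lt_le_trans dc.
exists c => //; apply/eqP; rewrite eq_le avg_le_g//= leNgt; apply/negP => cg.
have [|||r rdD] := abs (Num.max (avg u y c) (Num.max ((u y + g y) / 2) ((g z + g y) / 2))).
- by rewrite !le_max lexx orbT.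
- by rewrite !le_max lexx !orbT.
- by rewrite !gt_max cg/=; apply/andP; split; lra.
- rewrite gt_max => /andP[]; rewrite ltNge cmax//.
Qed.

End maximal_average.

(** * Uniform differentiability of averages *)

Section almost_additive.
Context (R : realType).
Implicit Types (T : R -> R) (del : nat -> R) (a s t K e : R).

Lemma almost_additive_natmul T d e t N : T 0 = 0 -> 0 < t -> N%:R * t < d ->
  (forall a s, `|a| < d -> `|s| < d -> `|T (a + s) - T a - T s| <= e * `|s|) ->
  `|T (N%:R * t) - N%:R * T t| <= e * (N%:R * t).
Proof.
move=> T0 t0 + H; elim: N => [|N IHN]; first by rewrite !mul0r T0 subrr normr0 mulr0.
rewrite -[N.+1%:R]natr1 !mulrDl !mul1r => Ntd.
have Nt0 : 0 <= N%:R * t by rewrite mulr_ge0// ltW.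
have /IHN : N%:R * t < d by lra.
have := H (N%:R * t) t; rewrite (ger0_norm Nt0) (gtr0_norm t0).
have -> : N%:R * t < d by lra.
have -> : t < d by lra.
move=> /(_ isT isT); move: (N%:R * t) (T _) (N%:R * T t) (T t) (T (N%:R * t)); clear.
move=> a b c d f; rewrite !ler_norml; lra.
Qed.

(** Write s = N t + r with N the integer part of s / t. Almost additivity costs e s in total, and
    the remainder r < t costs K t twice. *)
Lemma almost_additive_ratio T d K e s t : T 0 = 0 -> 0 < t -> t <= s -> s < d -> 0 <= e -> 
  (forall a, `|a| < d -> `|T a| <= K * `|a|) ->
  (forall a s, `|a| < d -> `|s| < d -> `|T (a + s) - T a - T s| <= e * `|s|) ->
  `|T s / s - T t / t| <= e + 2 * K * t / s.
Proof.
move=> T0 t0 ts sd e0 TK H.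
have s0 : 0 < s by exact: lt_le_trans ts.
pose N := Num.truncn (s / t).
have st0 : 0 <= s / t by rewrite divr_ge0// ltW.
have := truncn_itv st0; rewrite -/N ler_pdivlMr// ltr_pdivrMr// => /andP[Nle Nlt].
have Nt0 : 0 <= N%:R * t by rewrite mulr_ge0// ltW.
pose r := s - N%:R * t.
have r0 : 0 <= r by rewrite subr_ge0.
have rt : r < t by rewrite ltrBlDl -{2}(mul1r t) -mulrDl natr1.
have H1 := almost_additive_natmul T0 t0 (le_lt_trans Nle sd) H.
have H2 := H (N%:R * t) r; rewrite subrKC (ger0_norm Nt0) (ger0_norm r0) in H2.
have {}H2 := H2 (le_lt_trans Nle sd) (lt_le_trans rt (le_trans ts (ltW sd))).
have H3 := TK r; rewrite (ger0_norm r0) in H3; have {}H3 := H3 (lt_le_trans rt (le_trans ts (ltW sd))).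
have H4 := TK t; rewrite (gtr0_norm t0) in H4; have {}H4 := H4 (le_lt_trans ts sd).
have K0 : 0 <= K by rewrite -(pmulr_lge0 _ t0); exact: le_trans H4.
have H5 : `|T s - N%:R * T t| <= e * s + K * t.
  have : K * r <= K * t by rewrite ler_wpM2l// ltW.
  move: H1 H2 H3; have -> : e * r = e * s - e * (N%:R * t) by rewrite /r mulrBr.
  move: (T (N%:R * t)) (T r) (e * (N%:R * t)) (N%:R * T t) (T s) (K * r) (K * t) (e * s); clear.
  move=> a b c d f g h i; rewrite !ler_norml; lra.
have H6 : `|N%:R * T t - s * (T t / t)| <= K * t.
  have -> : N%:R * T t - s * (T t / t) = - (r * (T t / t)).
    by rewrite /r; field; rewrite gt_eqF.
  rewrite normrN normrM ger0_norm// normf_div (gtr0_norm t0).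
  have : `|T t| / t <= K by rewrite ler_pdivrMr.
  have : 0 <= `|T t| / t by rewrite divr_ge0// ltW.
  move: (`|T t| / t) => b; nra.
have -> : T s / s - T t / t = (T s - s * (T t / t)) / s by field; rewrite !gt_eqF.
rewrite normf_div (gtr0_norm s0) ler_pdivrMr// mulrDl divfK ?gt_eqF//.
move: H5 H6; move: (T s) (N%:R * T t) (s * _) => a b c; clear; rewrite !ler_norml; lra.
Qed.

(** The slope is the supremum of the lower bounds T(s)/s - 1/(k+1), each of which lies below every
    upper bound T(s)/s + 1/(k+1). *)
Lemma almost_additive_derivative T del K : T 0 = 0 -> (forall k, 0 < del k) ->
  (forall k a, `|a| < del k -> `|T a| <= K * `|a|) ->
  (forall k a s, `|a| < del k -> `|s| < del k -> `|T (a + s) - T a - T s| <= k.+1%:R^-1 * `|s|) ->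
  exists p, forall k s, `|s| < del k -> `|T s - p * s| <= 2 * k.+1%:R^-1 * `|s|.
Proof.
move=> T0 del0 TK H.
pose S := [set c | exists k s, [/\ 0 < s, s < del k & c = T s / s - k.+1%:R^-1]].
have Hub k s c : 0 < s -> s < del k -> S c -> c <= T s / s + k.+1%:R^-1.
  move=> s0 sk [k' [s' [s'0 s'k' ->]]]; apply/ler_addgt0Pr => e e0.
  have K0 : 0 <= K.
    have d20 : 0 < del 0 / 2 by rewrite divr_gt0.
    have := TK 0 (del 0 / 2); rewrite gtr0_norm// ltr_pdivrMr// ltr_pMr// ltr1n => /(_ isT) H0.
    by rewrite -(pmulr_lge0 _ d20); exact: le_trans H0.
  pose C := 2 * K * (s^-1 + s'^-1).
  have C0 : 0 <= C by rewrite !mulr_ge0 ?addr_ge0 ?invr_ge0 ?(ltW s0) ?(ltW s'0).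
  have C10 : 0 < C + 1 by rewrite ltr_wpDl.
  (* Both quotients are compared with T(t)/t; this choice keeps the sum of the two remainder terms
     below [e]. *)
  pose t := Num.min (Num.min s s') (e / (C + 1)).
  have t0 : 0 < t by rewrite !lt_min s0 s'0 divr_gt0.
  have [ts ts' tC] : [/\ t <= s, t <= s' & C * t <= e].
    split; [by rewrite !ge_min lexx|by rewrite !ge_min lexx !orbT|].
    apply: (@le_trans _ _ ((C + 1) * t)); first by rewrite ler_wpM2r ?lerDl// ltW.
    by rewrite mulrC -ler_pdivlMr// ge_min lexx orbT.
  have inv0 j : 0 <= j.+1%:R^-1 :> R by rewrite invr_ge0.
  have := almost_additive_ratio T0 t0 ts sk (inv0 k) (TK k) (H k).
  have := almost_additive_ratio T0 t0 ts' s'k' (inv0 k') (TK k') (H k').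
  have : 2 * K * t / s' + 2 * K * t / s <= e by move: tC; rewrite /C; lra.
  move: (2 * K * t / s') (2 * K * t / s) (T s / s) (T s' / s') (T t / t) (k.+1%:R^-1) (k'.+1%:R^-1); clear.
  by move=> a b c d f g h; rewrite !ler_norml; lra.
have inh : has_sup S.
  have d20 : 0 < del 0 / 2 by rewrite divr_gt0.
  have d2 : del 0 / 2 < del 0 by rewrite ltr_pdivrMr// ltr_pMr// ltr1n.
  split; first by exists (T (del 0 / 2) / (del 0 / 2) - 1%:R^-1), 0, (del 0 / 2).
  by exists (T (del 0 / 2) / (del 0 / 2) + 1%:R^-1) => c; exact: (Hub 0).
have pos k s : 0 < s -> s < del k -> `|T s - sup S * s| <= k.+1%:R^-1 * s.
  move=> s0 sk.
  have H1 : T s / s - k.+1%:R^-1 <= sup S by apply: sup_upper_bound => //; exists k, s.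
  have H2 : sup S <= T s / s + k.+1%:R^-1.
    by apply: ge_sup => [|c Sc]; [exact: inh.1|exact: (Hub k s c)].
  have -> : T s - sup S * s = (T s / s - sup S) * s by rewrite mulrBl divfK// gt_eqF.
  rewrite normrM (gtr0_norm s0) ler_pM2r//; move: (k.+1%:R^-1) (T s / s) (sup S) H1 H2 => a b c; rewrite ler_norml; lra.
exists (sup S) => k s sk.
have inv0 : 0 <= k.+1%:R^-1 :> R by rewrite invr_ge0.
have [s0|s0|s0] := ltgtP s 0; last by rewrite s0 T0 mulr0 subrr normr0 mulr0.
  (* Negative [s] is reduced to [- s] by almost additivity, which accounts for the factor 2 in the
     conclusion. *)
  have := H k (- s) s; rewrite normrN => /(_ sk sk).
  move: sk; rewrite addNr T0 (ltr0_norm s0) => sk.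
  have := pos k (- s); rewrite oppr_gt0 => /(_ s0 sk).
  move: (T (- s)) (T s) (sup S) (k.+1%:R^-1) => a b p e; rewrite !ler_norml; lra.
move: sk; rewrite (gtr0_norm s0) => sk; apply: le_trans (pos k s s0 sk) _.
by rewrite ler_wpM2r ?(ltW s0)//; move: (k.+1%:R^-1) inv0 => a; lra.
Qed.

End almost_additive.

Section almost_additive_rV.
Context (R : realType) (n : nat).
Implicit Types (T : 'rV[R]_n -> R) (del : nat -> R) (K : R) (a h p : 'rV[R]_n).

Definition prefix_rV h j : 'rV[R]_n := \row_i (if (i < j)%N then h ord0 i else 0).

Lemma enorm_prefix_rV h j : enorm (prefix_rV h j) <= enorm h.
Proof.
rewrite ler_wsqrtr// ler_sum// => i _; rewrite mxE.
by case: ifP => // _; rewrite expr0n sqr_ge0.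
Qed.

Lemma prefix_rV_size h : prefix_rV h n = h.
Proof. by apply/rowP => i; rewrite mxE ltn_ord. Qed.

Lemma prefix_rV0 h : prefix_rV h 0 = 0.
Proof. by apply/rowP => i; rewrite !mxE. Qed.

Lemma prefix_rVS h (j : 'I_n) : prefix_rV h j.+1 = prefix_rV h j + h ord0 j *: delta_mx 0 j.
Proof.
apply/rowP => i; rewrite !mxE eqxx ltnS leq_eqVlt; have [->|ij] := eqVneq i j.
  by rewrite eqxx ltnn/= mulr1 add0r.
by rewrite (negbTE ij : (i == j :> nat) = false)/= mulr0 addr0.
Qed.

Lemma enorm_delta (c : R) (j : 'I_n) : enorm (c *: delta_mx 0 j : 'rV[R]_n) = `|c|.
Proof.
rewrite enormZ (_ : enorm (delta_mx 0 j) = 1) ?mulr1// /enorm (bigD1 j)//= big1.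
  by rewrite mxE !eqxx addr0 expr1n sqrtr1.
by move=> i ij; rewrite mxE (negbTE ij) andbF expr0n.
Qed.

Lemma dot_delta p (c : R) (j : 'I_n) : dot p (c *: delta_mx 0 j) = p ord0 j * c.
Proof.
rewrite /dot (bigD1 j)//= big1 ?addr0; last by move=> i ij; rewrite !mxE (negbTE ij) andbF !mulr0.
by rewrite !mxE !eqxx mulr1.
Qed.

(** The partial derivatives come from the one-dimensional case. Building [h] up one coordinate at a
    time costs 1/(k+1) for additivity and 2/(k+1) for the derivative at each of the n steps,
    relative to |h|. *)
Lemma almost_additive_gradient T del K : T 0 = 0 -> (forall k, 0 < del k) ->
  (forall k a, enorm a < del k -> `|T a| <= K * enorm a) ->
  (forall k a h, enorm a < del k -> enorm h < del k ->
    `|T (a + h) - T a - T h| <= k.+1%:R^-1 * enorm h) ->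
  exists p, forall k h, enorm h < del k -> `|T h - dot p h| <= 3 * n%:R * k.+1%:R^-1 * enorm h.
Proof.
move=> T0 del0 TK H.
have H1 (i : 'I_n) : exists pi, forall k s, `|s| < del k ->
    `|T (s *: delta_mx 0 i) - pi * s| <= 2 * k.+1%:R^-1 * `|s|.
  apply: (@almost_additive_derivative _ (fun s => T (s *: delta_mx 0 i)) del K) => //.
  - by rewrite scale0r.
  - by move=> k a ak; rewrite -(enorm_delta a i); apply: (TK k); rewrite enorm_delta.
  - by move=> k a s ak sk; rewrite scalerDl -(enorm_delta s i); apply: H; rewrite enorm_delta.
exists (\row_i sval (cid (H1 i))) => k h hk; set p := \row_i _.
have e0 : 0 <= k.+1%:R^-1 * enorm h by rewrite mulr_ge0 ?enorm_ge0.
suff G j : (j <= n)%N -> `|T (prefix_rV h j) - dot p (prefix_rV h j)| <= 3 * j%:R * (k.+1%:R^-1 * enorm h).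
  by have := G n (leqnn n); rewrite prefix_rV_size mulrA.
elim: j => [|j IHj] jn; first by rewrite prefix_rV0 T0 dot0r subrr normr0 mulr0 mul0r.
have {}IHj := IHj (ltnW jn); pose i := Ordinal jn.
have hi : `|h ord0 i| <= enorm h := le_trans (mx_coord_le_norm _ _ _) (norm_le_enorm _).
rewrite -[j.+1]/((i : nat).+1) prefix_rVS dotDr dot_delta {2}/p mxE.
case: cid => pi /= /(_ k (h ord0 i) (le_lt_trans hi hk)).
have := H k (prefix_rV h i) (h ord0 i *: delta_mx 0 i).
rewrite enorm_delta => /(_ (le_lt_trans (enorm_prefix_rV _ _) hk) (le_lt_trans hi hk)).
move: IHj; rewrite -[j]/(i : nat) -(natr1 i).
have : k.+1%:R^-1 * `|h ord0 i| <= k.+1%:R^-1 * enorm h by rewrite ler_wpM2l.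
rewrite -[2 * _ * _]mulrA.
move: (k.+1%:R^-1 * `|h ord0 i|) (k.+1%:R^-1 * enorm h) e0 => a b b0.
move: (T (prefix_rV h i + _)) (T (prefix_rV h i)) (T (h ord0 i *: _)) (pi * _) (dot p _) (i%:R); clear.
by move=> c d f g k l; rewrite !ler_norml; lra.
Qed.

End almost_additive_rV.

(** * A common modulus of differentiability for ball averages *)

Section uniform_gradient.
Context (R : realType) (n : nat) (u : 'rV[R]_n -> R).
Hypothesis cu : continuous u.
Implicit Types (x y a h p : 'rV[R]_n) (r : R).

Lemma uniform_continuity_bounded (C e : R) : 0 < e -> exists2 d : R, 0 < d &
  forall y a, enorm y <= C -> enorm a < d -> `|u (y + a) - u y| <= e.
Proof.
move=> e0.
have : \forall a \near (0 : 'rV[R]_n), [set y : 'rV[R]_n | `|y| <= C] `<=` [set y | `|u (y + a) - u y| <= e].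
  have /compact_near_coveringP cov := @mx_bounded_compact R 1 n C.
  apply: (cov _ (nbhs (0 : 'rV[R]_n)) (fun a y => `|u (y + a) - u y| <= e)).
  move=> y0 _; have e20 : 0 < e / 2 by rewrite divr_gt0.
  have /cvgrPdist_le/(_ (e / 2) e20)/nbhs_enorm[d d0 H] := @cu y0.
  have d20 : 0 < d / 2 by rewrite divr_gt0.
  near=> y a.
  have yd : enorm (y - y0) < d / 2 by near: y; exact: near_enorm.
  have ad : enorm (a - 0) < d / 2 by near: a; exact: near_enorm.
  have : `|u y0 - u y| <= e / 2 by apply: H; lra.
  have : `|u y0 - u (y + a)| <= e / 2.
    apply: H; rewrite addrAC; apply: le_lt_trans (ler_enormD _ _) _.
    by rewrite subr0 in ad; lra.
  by move: (u y0) (u y) (u (y + a)) => b c f; rewrite !ler_norml; lra.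
move=> /nbhs_enorm[d d0 H]; exists d => // y a yC ad.
apply: (H a); first by rewrite subr0.
exact: le_trans (norm_le_enorm y) yC.
Unshelve. all: by end_near. Qed.

(** Uniform continuity of [u] on a ball depending only on [m] makes the increments of the average
    almost additive, with a modulus independent of [x] and [r]. *)
Lemma avg_uniform_gradient (m : R) : 1 <= m -> exists2 del : nat -> R, (forall k, 0 < del k) &
  forall x r, enorm x <= m -> m^-1 <= r <= m -> exists p, forall k h, enorm h < del k ->
    `|avg u (x + h) r - avg u x r - dot p h| <= k.+1%:R^-1 * enorm h.
Proof.
move=> m1; have m0 : 0 < m by lra.
(* The constant of [avg_shift], with 1 / r bounded by [m]. *)
pose C : R := 2 * 3 ^+ n * m.
have C0 : 0 < C by rewrite !mulr_gt0 ?exprn_gt0.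
have H k : exists d : R, [/\ 0 < d, d <= m^-1 &
    forall y a, enorm y <= m + m + m^-1 -> enorm a < d -> `|u (y + a) - u y| <= k.+1%:R^-1 / C].
  have e0 : 0 < k.+1%:R^-1 / C by rewrite divr_gt0// invr_gt0.
  have [d d0 dH] := uniform_continuity_bounded (m + m + m^-1) e0.
  exists (Num.min d m^-1); split; [by rewrite lt_min d0 invr_gt0|by rewrite ge_min lexx orbT|].
  by move=> y a ym; rewrite lt_min => /andP[ad _]; exact: dH.
have {H}[del /all_and3[del0 delm delH]] := choice H.
(* Reindexing absorbs the factor 3n of [almost_additive_gradient]; the successor of this index is
   (3n+1)(k+1). *)
exists (fun k => del ((3 * n).+1 * k.+1).-1%N) => [k|x r xm /andP[mr rm]]; first exact: del0.
have r0 : 0 < r by apply: lt_le_trans mr; rewrite invr_gt0.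
have rm1 : r^-1 <= m by rewrite -[leRHS]invrK lef_pV2// posrE ?invr_gt0.
have [M M0 uM] := continuous_bounded_eball 0 (m + m + m^-1) cu.
have inB h z : enorm h <= m^-1 -> eball x (r + enorm h) z -> enorm z < m + m + m^-1.
  move=> hm; rewrite /eball/= => zx; rewrite -(subrK x z).
  by apply: le_lt_trans (ler_enormD _ _) _; lra.
pose T h := avg u (x + h) r - avg u x r.
have [||||p pH] := @almost_additive_gradient _ n T del (M * C).
- by rewrite /T addr0 subrr.
- exact: del0.
- move=> k h hk; have hm := le_trans (ltW hk) (delm k).
  apply: le_trans (avg_shift r0 (le_trans hm mr) cu (M := M) _) _.
    by move=> z /(inB _ _ hm) zB; apply: uM; rewrite /eball/= subr0.
  rewrite /C; have -> : M * (2 * 3 ^+ n * m) * enorm h = M * 2 * 3 ^+ n * enorm h * m by ring.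
  by rewrite ler_wpM2l// !mulr_ge0 ?exprn_ge0 ?enorm_ge0.
- move=> k a h ak hk; have hm := le_trans (ltW hk) (delm k).
  (* The second difference T(a + h) - T(a) - T(h) is the increment by [h] of the averages of [w],
     and [w] is uniformly small. *)
  pose w y := u (y + a) + (-1) * u y.
  have cua : continuous (fun y => u (y + a)).
    move=> y; apply: (@continuous_comp _ _ _ (fun y => y + a) u); last exact: cu.
    by apply: (@nonexpansive_continuous _ _ _ _ 1) => b c; rewrite opprD addrACA subrr addr0 mul1r.
  have cw : continuous w by apply: continuous_add => //; exact: continuous_scale.
  have E y : avg w y r = avg u (y + a) r - avg u y r.
    rewrite avgD//; last exact: continuous_scale.
    by rewrite avgZ// -avg_translate// mulN1r.
  have -> : T (a + h) - T a - T h = avg w (x + h) r - avg w x r.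
    rewrite !E /T (addrC a h) addrA.
    move: (avg u (x + h + a) r) (avg u (x + a) r) (avg u (x + h) r) (avg u x r); clear => b c d f; ring.
  apply: le_trans (avg_shift r0 (le_trans hm mr) cw (M := k.+1%:R^-1 / C) _) _.
    move=> z /(inB _ _ hm) zB; rewrite /w mulN1r.
    by apply: delH => //; exact: ltW.
  have -> : k.+1%:R^-1 / C * 2 * 3 ^+ n * enorm h / r = (k.+1%:R^-1 * enorm h) * (r^-1 / m).
    by rewrite /C; field; rewrite !gt_eqF//= ?andbT ?exprn_gt0.
  rewrite ler_piMr ?mulr_ge0 ?enorm_ge0//.
  by rewrite ler_pdivrMr// mul1r.
exists p => k h hk; apply: le_trans (pH _ _ hk) _.
rewrite ler_wpM2r ?enorm_ge0// prednK ?muln_gt0// natrM invfM mulrA.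
rewrite ler_piMl// ler_pdivrMr ?ltr0n// mul1r -natrM ler_nat.
by [].
Qed.

End uniform_gradient.

(** * Subgradients with a fixed modulus *)

Section uniform_subgradient.
Context (R : realType) (n : nat) (g : 'rV[R]_n -> R).
Hypothesis cg : continuous g.
Implicit Types (x y z h p q : 'rV[R]_n) (e : R) (del : nat -> R).

(* Frechet subgradients with a prescribed modulus; unlike that of the plain
   Frechet subdifferential, the graph of this relation is closed. *)
Definition unif_subgrad del x p := forall k z, enorm (z - x) < del k ->
  g x + dot p (z - x) - k.+1%:R^-1 * enorm (z - x) <= g z.

(** If [p] is a subgradient at [x], the inequalities at [x] and at [y] bound the increment from both
    sides. If not, an inequality violated strictly at some [z] stays violated for all nearby [y] and
    [q]. Hence the graph is closed. *)
Lemma unif_subgrad_near del x p e : (forall k, 0 < del k) -> 0 < e ->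
  exists2 d : R, 0 < d & forall q y, enorm (q - p) < d -> enorm (y - x) < d ->
    unif_subgrad del y q ->
    unif_subgrad del x p /\ `|g y - g x - dot p (y - x)| <= e * enorm (y - x).
Proof.
move=> del0 e0; have [px|px] := pselect (unif_subgrad del x p).
  have e20 : 0 < e / 2 by rewrite divr_gt0.
  have [k ke] := exists_natSinv_lt e20.
  exists (Num.min (e / 2) (del k)) => [|q y]; first by rewrite lt_min e20 del0.
  rewrite !lt_min => /andP[qp _] /andP[_ yx] /(_ k x).
  have H0 := enorm_ge0 (y - x).
  have H1 := px k y yx; rewrite -opprB enormN => /(_ yx) H2; split=> //.
  have H3 := dot_le (q - p) (y - x).
  have H4 : enorm (q - p) * enorm (y - x) <= e / 2 * enorm (y - x) by rewrite ler_wpM2r// ltW.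
  have H5 : k.+1%:R^-1 * enorm (y - x) <= e / 2 * enorm (y - x) by rewrite ler_wpM2r// ltW.
  move: H1 H2 H3 H4 H5; rewrite dotNr dotBl.
  move: (k.+1%:R^-1) (enorm (q - p)) (dot q _) (dot p _) (g y) (g x) (enorm (y - x)); clear.
  by move=> a b c d f i j; rewrite !ler_norml; lra.
have [k [z [zx zlt]]] : exists k z, enorm (z - x) < del k /\
    g z < g x + dot p (z - x) - k.+1%:R^-1 * enorm (z - x).
  move/existsNP : px => [k /existsNP[z /not_implyP[zx /negP]]].
  by rewrite -ltNge => ?; exists k, z.
(* Passing from (x, p) to (y, q) makes four errors, each kept below a quarter of the violation. *)
pose gap := g x + dot p (z - x) - k.+1%:R^-1 * enorm (z - x) - g z.
have gap0 : 0 < gap by rewrite subr_gt0.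
have gap40 : 0 < gap / 4 by rewrite divr_gt0.
have /cvgrPdist_lt/(_ (gap / 4) gap40)/nbhs_enorm[d1 d10 H1] := @cg x.
have ep0 : 0 < enorm p + 1 by rewrite ltr_wpDl ?enorm_ge0.
pose d2 := del k - enorm (z - x).
have d20 : 0 < d2 by rewrite subr_gt0.
exists (Num.min (Num.min d1 d2) (Num.min (gap / 4 / (enorm p + 1)) (gap / 4 / del k))).
  by rewrite !lt_min d10 d20 !divr_gt0.
move=> q y; rewrite !lt_min => /andP[_ /andP[_ qp]] /andP[/andP[y1 y2] /andP[y3 _]] /(_ k z).
have zy : enorm (z - y) <= enorm (z - x) + enorm (y - x).
  by rewrite -(enormN (y - x)) opprB -[X in enorm X <= _](subrKA x) ler_enormD.
have zyk : enorm (z - y) < del k by move: y2 zy; rewrite /d2; lra.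
have A1 := H1 y y1.
have A2 : `|dot (q - p) (z - y)| < gap / 4.
  apply: le_lt_trans (dot_le _ _) _; move: qp; rewrite ltr_pdivlMr//; apply: le_lt_trans.
  by rewrite ler_wpM2l ?enorm_ge0// ltW.
have A3 : `|dot p (y - x)| < gap / 4.
  apply: le_lt_trans (dot_le _ _) _; move: y3; rewrite ltr_pdivlMr// mulrC; apply: le_lt_trans.
  by rewrite ler_wpM2r ?enorm_ge0// lerDl.
have A4 : k.+1%:R^-1 * enorm (z - y) <= k.+1%:R^-1 * enorm (z - x) + enorm (y - x).
  apply: (@le_trans _ _ (k.+1%:R^-1 * (enorm (z - x) + enorm (y - x)))); first by rewrite ler_wpM2l.
  by rewrite mulrDr lerD2l ler_piMl ?enorm_ge0// invf_le1// ler1n.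
have A5 : enorm (y - x) < gap / 4.
  apply: lt_le_trans y3 _; rewrite ler_pdivrMr// ler_peMr ?(ltW gap40)//.
  by rewrite lerDr enorm_ge0.
have E : dot q (z - y) = dot (q - p) (z - y) + dot p (z - x) - dot p (y - x).
  by rewrite -addrA -[dot p _ - _]dotBr dotBl (_ : z - x - (y - x) = z - y) ?subrK// opprB addrA subrK.
move=> /(_ zyk); rewrite E; move: A1 A2 A3 A4 A5; rewrite /gap.
move: (k.+1%:R^-1 * enorm (z - y)) (k.+1%:R^-1 * enorm (z - x)) (enorm (y - x)) (dot (q - p) _) (dot p _) (dot p _) (g x) (g y) (g z); clear.
by move=> a b c d f i j l m; rewrite !ltr_norml => *; exfalso; lra.
Qed.

Lemma unif_subgrad_bounded del x : 0 < del 0 -> exists2 C : R, 0 <= C &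
  forall y p, enorm (y - x) < 1 -> unif_subgrad del y p -> enorm p <= C.
Proof.
move=> d0; pose t := del 0 / 2.
have t0 : 0 < t by rewrite divr_gt0.
have td : t < del 0 by rewrite ltr_pdivrMr// ltr_pMr// ltr1n.
have [M M0 gM] := continuous_bounded_eball x (1 + t + 1) cg.
exists ((M + M + t) / t); first by rewrite divr_ge0 ?(ltW t0)// !addr_ge0// ltW.
move=> y p yx py; have [->|p0] := eqVneq p 0.
  by rewrite enorm0 divr_ge0 ?(ltW t0)// !addr_ge0// ltW.
have ep : 0 < enorm p by rewrite lt_def enorm_eq0 p0 enorm_ge0.
(* Testing the inequality with k = 0 at distance [t] in the direction of [p] gives t |p| <= g(z) -
   g(y) + t. *)
pose z := y + (t / enorm p) *: p.
have zy : z - y = (t / enorm p) *: p by rewrite /z addrAC subrr add0r.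
have ezy : enorm (z - y) = t.
  by rewrite zy enormZ gtr0_norm ?divr_gt0// divfK// gt_eqF.
have := py 0 z; rewrite ezy => /(_ td); rewrite zy dotZr dotxx invr1 mul1r.
have -> : t / enorm p * enorm p ^+ 2 = t * enorm p by field; rewrite gt_eqF.
have := gM y; rewrite /eball/= => /(_ ltac:(lra)).
have /gM : enorm (z - x) < 1 + t + 1.
  by rewrite -(subrKA y); apply: le_lt_trans (ler_enormD _ _) _; lra.
rewrite ler_pdivlMr// [enorm p * t]mulrC.
by move: (g z) (g y) (t * _) => a b c; rewrite !ler_norml; lra.
Qed.

(* Outer semicontinuity of the subgradients turns uniqueness at x into a
   first-order expansion along the points where some subgradient exists. *)
Lemma unif_subgrad_unique del x p e : (forall k, 0 < del k) -> 0 < e ->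
  (forall q, unif_subgrad del x q -> q = p) ->
  \forall y \near x, forall q, unif_subgrad del y q ->
    `|g y - g x - dot p (y - x)| <= e * enorm (y - x).
Proof.
move=> del0 e0 uniq; have [C C0 HC] := unif_subgrad_bounded x (del0 0).
(* Subgradients at points near [x] stay in a compact set, so it suffices to argue near each
   candidate limit, which uniqueness identifies with [p]. *)
have /compact_near_coveringP cov := @mx_bounded_compact R 1 n C.
have H := cov _ (nbhs x) (fun y q => unif_subgrad del y q -> `|g y - g x - dot p (y - x)| <= e * enorm (y - x)).
near=> y => q qy.
have y1 : enorm (y - x) < 1 by near: y; exact: near_enorm.
have qC : `|q| <= C := le_trans (norm_le_enorm q) (HC y q y1 qy).
move: q qC qy; near: y; apply: H => q0 _.
have [d d0 Hd] := unif_subgrad_near x q0 del0 e0.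
near=> q y => qy.
have qq : enorm (q - q0) < d by near: q; exact: near_enorm.
have yx : enorm (y - x) < d by near: y; exact: near_enorm.
by have [/uniq <-] := Hd q y qq yx qy.
Unshelve. all: by end_near. Qed.

End uniform_subgradient.

(** * Tangential sets *)

Section tangential_sets.
Context (R : realType) (n : nat).
Implicit Types (x y z h p q w : 'rV[R]_n) (e : R) (E : set 'rV[R]_n).

Lemma dotE p h : dot p h = (h *m p^T) 0 0.
Proof. by rewrite mxE; apply: eq_bigr => i _; rewrite mxE mulrC. Qed.

Lemma sub_kermx_dot w v : (v <= kermx w^T)%MS = (dot w v == 0).
Proof.
rewrite (sameP sub_kermxP eqP) dotE; apply/eqP/eqP => [->|H]; first by rewrite mxE.
by rewrite [LHS]mx11_scalar H; apply/matrixP => i j; rewrite !mxE mul0rn.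
Qed.

Lemma rank_hyperplane w : w != 0 -> (\rank (kermx w^T)).+1 = n.
Proof.
move=> w0; rewrite mxrank_ker mxrank_tr rank_rV w0 -subSn ?subn1//.
rewrite lt0n; apply: contra w0 => /eqP n0; apply/eqP/rowP => i.
by have := leq_ltn_trans (leq0n i) (ltn_ord i); rewrite lt0n => /eqP.
Qed.

(** The difference of the two sides lies in the hyperplane and is orthogonal to it, hence to
    itself. *)
Lemma npart_hyperplane w h : w != 0 -> npart (kermx w^T) h = (dot w h / enorm w ^+ 2) *: w.
Proof.
move=> w0; have ew0 : enorm w ^+ 2 != 0 by rewrite expf_neq0// enorm_eq0.
have [tV /orthcP nV tnE] := tnpartP (kermx w^T) h.
move: tV; rewrite sub_kermx_dot => /eqP tV.
set s := npart _ _ in nV tnE *.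
have sE : dot w h = dot w s by rewrite -tnE dotDr tV add0r.
rewrite sE; set c := _ / _; pose v := s - c *: w.
have wv : dot w v = 0 by rewrite /v dotBr dotZr dotxx /c divfK ?subrr.
have sv : dot s v = 0 by apply: nV; rewrite sub_kermx_dot wv.
have : enorm v ^+ 2 = 0 by rewrite -dotxx {1}/v dotBl dotZl sv wv mulr0 subrr.
by move/eqP; rewrite expf_eq0/= enorm_eq0 subr_eq0 => /eqP.
Qed.

(** The bound e <= 1/2 keeps the tangential part at least |h| / 2, so the value +oo of
    [normal_ratio] does not occur. *)
Lemma normal_ratio_hyperplane w h e : w != 0 -> h != 0 -> 0 < e -> e <= 1 / 2 ->
  `|dot w h| <= e * enorm w * enorm h ->
  exists2 r, normal_ratio (kermx w^T) h = r%:E & 0 <= r <= 2 * e.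
Proof.
move=> w0 h0 e0 e2 wh.
have ew : 0 < enorm w by rewrite lt_def enorm_eq0 w0 enorm_ge0.
have eh : 0 < enorm h by rewrite lt_def enorm_eq0 h0 enorm_ge0.
have nE : enorm (npart (kermx w^T) h) <= e * enorm h.
  rewrite npart_hyperplane// enormZ normf_div (ger0_norm (sqr_ge0 _)).
  have -> : `|dot w h| / enorm w ^+ 2 * enorm w = `|dot w h| / enorm w by field; rewrite gt_eqF.
  by rewrite ler_pdivrMr// mulrAC.
have tE : enorm h / 2 <= enorm (tpart (kermx w^T) h).
  have [_ _ tnE] := tnpartP (kermx w^T) h.
  have := ler_enormD (tpart (kermx w^T) h) (npart (kermx w^T) h); rewrite tnE.
  have : e * enorm h <= 1 / 2 * enorm h by rewrite ler_wpM2r// ltW.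
  move: nE; move: (enorm (npart _ _)) (enorm (tpart _ _)) (enorm h); clear.
  by move=> a b c; lra.
have t0 : 0 < enorm (tpart (kermx w^T) h) by apply: lt_le_trans tE; rewrite divr_gt0.
rewrite /normal_ratio -enorm_eq0 gt_eqF//.
exists (enorm (npart (kermx w^T) h) / enorm (tpart (kermx w^T) h)) => //.
rewrite divr_ge0 ?enorm_ge0//= ler_pdivrMr//; apply: le_trans nE _.
by rewrite -mulrA mulrCA ler_wpM2l ?(ltW e0)//; lra.
Qed.

(** The working criterion for tangentiality: at each point, increments within the set are
    asymptotically orthogonal to some nonzero vector. *)
Lemma tangential_hyperplane E :
  (forall x, E x -> exists2 w, w != 0 & forall e, 0 < e ->
     \forall y \near x, E y -> `|dot w (y - x)| <= e * enorm (y - x)) ->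
  tangential E.
Proof.
move=> HE x /HE[w w0 Hw]; exists (kermx w^T); split; first exact: rank_hyperplane.
move=> h h0 Eh hcvg.
have ew : 0 < enorm w by rewrite lt_def enorm_eq0 w0 enorm_ge0.
have near_ratio e : 0 < e -> e <= 1 / 2 ->
    \forall i \near \oo, exists2 r, normal_ratio (kermx w^T) (h i) = r%:E & 0 <= r <= 2 * e.
  move=> e0 e2; have ewe : 0 < e * enorm w by rewrite mulr_gt0.
  have /nbhs_enorm[d d0 Hd] := Hw _ ewe.
  have /hcvg Hn : nbhs (0 : 'rV[R]_n) [set y | enorm (y - 0) < d] by exact: near_enorm.
  have {}Hn : \forall i \near \oo, enorm (h i - 0) < d := Hn.
  apply: filterS Hn => i /=; rewrite subr0 => hd; apply: normal_ratio_hyperplane => //.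
  have := Hd (x + h i); rewrite addrAC subrr add0r; exact.
apply/fine_cvgP; split.
  have h12 : 0 < 1 / 2 :> R by lra.
  by apply: filterS (near_ratio _ h12 (lexx _)) => i [r ->].
apply/cvgrPdist_le => e e0.
have m0 : 0 < Num.min (e / 2) (1 / 2) by rewrite lt_min divr_gt0//; lra.
apply: filterS (near_ratio _ m0 _) => [i [r /= -> /andP[r0]]|]; last by rewrite ge_min lexx orbT.
rewrite sub0r normrN ger0_norm//= => rm; apply: le_trans rm _.
by rewrite mulrC -ler_pdivlMr// ge_min lexx.
Qed.

Lemma sigma_tangential_sub E F : E `<=` F -> sigma_tangential F -> sigma_tangential E.
Proof. by move=> EF [T [tT FT]]; exists T; split=> // x /EF/FT. Qed.

Lemma tangential_sigma E : tangential E -> sigma_tangential E.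
Proof. by move=> tE; exists (fun=> E); split=> // x Ex; exists 0. Qed.

Lemma tangential0 : tangential (set0 : set 'rV[R]_n).
Proof. by []. Qed.

Lemma sigma_tangential_bigcup (I : countType) (E : I -> set 'rV[R]_n) :
  (forall i, sigma_tangential (E i)) -> sigma_tangential (\bigcup_i E i).
Proof.
move=> /choice[T HT].
exists (fun k => if unpickle k is Some (i, j) then T i j else set0); split.
  by move=> k; case: unpickle => [[i j]|]; [exact: (HT i).1|exact: tangential0].
move=> x [i _ /(HT i).2[j _ Tx]]; exists (pickle (i, j)) => //.
by rewrite pickleK.
Qed.

Lemma sigma_tangentialU E F : sigma_tangential E -> sigma_tangential F -> sigma_tangential (E `|` F).
Proof.
move=> tE tF; apply: (@sigma_tangential_sub _ (\bigcup_b (if b then E else F))).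
  by move=> x [Ex|Fx]; [exists true|exists false].
by apply: sigma_tangential_bigcup; case.
Qed.

End tangential_sets.

(** * Points with several uniform subgradients *)

Section nonunique_subgradients.
Context (R : realType) (n : nat) (g : 'rV[R]_n -> R) (del : nat -> R).
Hypotheses (cg : continuous g) (del0 : forall k, 0 < del k).
Implicit Types (x y z h p q w : 'rV[R]_n) (e K : R).
Local Notation G := (unif_subgrad g del).

Lemma mx_norm_mul a b c (A : 'M[R]_(a, b)) (B : 'M[R]_(b, c)) : `|A *m B| <= b%:R * `|A| * `|B|.
Proof.
apply: mx_norm_le => [|i j]; first by rewrite !mulr_ge0.
rewrite mxE; apply: le_trans (ler_norm_sum _ _ _) _.
rewrite -mulrA -[b in b%:R]card_ord mulr_natl -sumr_const; apply: ler_sum => k _.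
by rewrite normrM ler_pM// mx_coord_le_norm.
Qed.

Lemma row_norm_le a b (A : 'M[R]_(a, b)) i : `|row i A| <= `|A|.
Proof. by apply: mx_norm_le => // j k; rewrite mxE mx_coord_le_norm. Qed.

Lemma usubmx_norm_le a b c (A : 'M[R]_(a + b, c)) : `|usubmx A| <= `|A|.
Proof. by apply: mx_norm_le => // j k; rewrite mxE mx_coord_le_norm. Qed.

Lemma dsubmx_norm_le a b c (A : 'M[R]_(a + b, c)) : `|dsubmx A| <= `|A|.
Proof. by apply: mx_norm_le => // j k; rewrite mxE mx_coord_le_norm. Qed.

Lemma rows_col_mx a b (A : 'M[R]_(a, n)) (B : 'M[R]_(b, n)) (P : 'rV[R]_n -> Prop) :
  (forall i, P (row i A)) -> (forall i, P (row i B)) -> forall i, P (row i (col_mx A B)).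
Proof. by move=> PA PB i; case: (split_ordP i) => j ->; rewrite ?rowKu ?rowKd. Qed.

(** A right inverse of [D] yields the constant. For fixed [K] this form of independence, unlike
    [row_free], passes to limits. *)
Lemma row_free_bound d (D : 'M[R]_(d, n)) : row_free D ->
  exists2 K, 0 <= K & forall c : 'rV[R]_d, `|c| <= K * `|c *m D|.
Proof.
move=> /row_freeP[L DL]; exists (n%:R * `|L|); first by rewrite mulr_ge0.
move=> c; rewrite -{1}[c]mulmx1 -DL mulmxA; apply: le_trans (mx_norm_mul _ _) _.
by rewrite mulrAC.
Qed.

Lemma bound_row_free d (D : 'M[R]_(d, n)) K :
  (forall c : 'rV[R]_d, `|c| <= K * `|c *m D|) -> row_free D.
Proof.
move=> H; rewrite -kermx_eq0; apply/eqP/row_matrixP => i; rewrite row0; apply/eqP.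
rewrite -normr_le0; apply: le_trans (H _) _.
by rewrite -row_mul mulmx_ker row0 normr0 mulr0.
Qed.

Lemma row_free_col_mx d (D : 'M[R]_(d, n)) w : row_free D -> ~~ row_free (col_mx w D) ->
  exists c : 'rV[R]_d, w = c *m D.
Proof.
move=> fD nf; apply/submxP.
have le : (D <= w + D)%MS by exact: addsmxSr.
suff : (w + D <= D)%MS by rewrite addsmx_sub => /andP[].
rewrite -(mxrank_leqif_sup le) eqn_leq mxrankS//=.
move: nf; rewrite /row_free addsmxE neq_ltn => /orP[|].
  by move/eqP: fD => -> H1; exact: H1.
by rewrite ltnNge rank_leq_row.
Qed.

Lemma near_dist (V : normedModType R) (v : V) e : 0 < e -> \forall v' \near v, `|v - v'| < e.
Proof. by move=> e0; apply: cvgr_dist_lt => //; exact: cvg_id. Qed.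

Lemma near_dist_mx a b (A : 'M[R]_(a, b)) e : 0 < e -> \forall B \near A, `|A - B| < e.
Proof. by move=> e0; exact: (@near_dist 'M[R]_(a, b)). Qed.

(* The points x at which the differences of subgradients span a space of
   dimension d, witnessed by d differences whose linear independence is
   quantified by K. *)
Definition nonunique d K x :=
  [/\ exists M : 'M[R]_(d + d, n), [/\ `|M| <= K, forall i, G x (row i M) &
        forall c : 'rV[R]_d, `|c| <= K * `|c *m (usubmx M - dsubmx M)|],
      forall M : 'M[R]_(d.+1 + d.+1, n), (forall i, G x (row i M)) ->
        ~~ row_free (usubmx M - dsubmx M) &
      exists p q, [/\ G x p, G x q & p != q]].

(* Approaching x along such points in a direction v, d independent differences
   of subgradients converge to differences of subgradients at x that annihilate
   v; by maximality of d these span all differences at x, so v is orthogonal to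
   p - q. *)
Lemma nonunique_tangential d K : tangential (nonunique d K).
Proof.
apply: tangential_hyperplane => x [_ maxd [p [q [Gp Gq pq]]]].
exists (p - q); first by rewrite subr_eq0.
move=> e e0.
have /compact_near_coveringP cov := @mx_bounded_compact R (d + d) n K.
have H := cov _ (nbhs x) (fun y (M : 'M[R]_(d + d, n)) => (forall i, G y (row i M)) ->
  (forall c : 'rV[R]_d, `|c| <= K * `|c *m (usubmx M - dsubmx M)|) ->
  `|dot (p - q) (y - x)| <= e * enorm (y - x)).
near=> y => -[[M [MK GM bM]] _ _]; move: M MK GM bM; near: y; apply: H => M0 M0K.
set D0 := usubmx M0 - dsubmx M0.
(* If the independence bound fails at [M0], it fails for all matrices near [M0], and there is
   nothing to show there. *)
have [fD0|/existsNP[c /negP]] := pselect (forall c : 'rV[R]_d, `|c| <= K * `|c *m D0|); last first.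
  rewrite -ltNge => cD0.
  have K0 : 0 <= K := le_trans (normr_ge0 _) M0K.
  pose L := K * (d%:R * `|c| * 2).
  have L0 : 0 <= L by rewrite !mulr_ge0.
  have L10 : 0 < L + 1 by rewrite ltr_wpDl.
  have gap : 0 < (`|c| - K * `|c *m D0|) / (L + 1).
    by rewrite divr_gt0 ?subr_gt0.
  near=> M y => /= _ /(_ c); have : `|M0 - M| < (`|c| - K * `|c *m D0|) / (L + 1) by near: M; exact: near_dist_mx.
  rewrite (ltr_pdivlMr _ _ L10) => MM cM; exfalso.
  have : K * `|c *m (usubmx M - dsubmx M)| <= K * `|c *m D0| + L * `|M0 - M|.
    rewrite /L -mulrA -mulrDr ler_wpM2l//.
    rewrite -[usubmx M - _](subrK D0) mulmxDr addrC; apply: le_trans (ler_normD _ _) _.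
    rewrite lerD2l; apply: le_trans (mx_norm_mul _ _) _.
    rewrite -[leRHS]mulrA ler_wpM2l ?mulr_ge0//.
    have -> : usubmx M - dsubmx M - D0 = dsubmx (M0 - M) - usubmx (M0 - M).
      by rewrite /D0 !linearB/= ; apply/matrixP => i j; rewrite !mxE; ring.
    apply: le_trans (ler_normB _ _) _.
    by rewrite mulr_natl mulr2n lerD ?dsubmx_norm_le ?usubmx_norm_le.
  have := normr_ge0 (M0 - M).
  move: cM MM; move: (K * `|c *m (_ - _)|) (K * `|c *m D0|) (`|c|) (`|M0 - M|); clear.
  move=> a b f i; nra.
have {}fD0 := bound_row_free fD0.
have row_near i (s : R) : 0 < s -> \forall M \near M0, enorm (row i M - row i M0) < s.
  move=> s0; have sn : 0 < s / n.+1%:R by rewrite divr_gt0.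
  near=> M; have : `|M0 - M| < s / n.+1%:R by near: M; exact: near_dist_mx.
  rewrite ltr_pdivlMr// mulrC -enormN opprB -linearB/=; apply: le_lt_trans.
  apply: le_trans (enorm_le_norm _) _; apply: ler_pM => //; first by rewrite ler_nat.
  exact: row_norm_le.
have [GM0|/existsNP[i nGi]] := pselect (forall i, G x (row i M0)); last first.
  have [s s0 Hs] := unif_subgrad_near cg x (row i M0) del0 ltr01.
  near=> M y => /= /(_ i) Gi _; exfalso; apply: nGi.
  have Ms : enorm (row i M - row i M0) < s by near: M; exact: row_near.
  have ys : enorm (y - x) < s by near: y; exact: near_enorm.
  by have [] := Hs _ _ Ms ys Gi.
(* Adjoining [p] and [q] to the two blocks of [M0] gives d + 1 differences of subgradients at [x],
   which are dependent by maximality. *)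
have [c cE] : exists c : 'rV[R]_d, p - q = c *m D0.
  apply: row_free_col_mx => //.
  pose M' : 'M[R]_(d.+1 + d.+1, n) := col_mx (col_mx p (usubmx M0)) (col_mx q (dsubmx M0)).
  have GM' i : G x (row i M').
    have row1 (r : 'rV[R]_n) k : row k r = r by apply/rowP => l; rewrite mxE ord1.
    apply: rows_col_mx => {}i; apply: rows_col_mx => {}i; rewrite ?row1// ?row_usubmx ?row_dsubmx//.
  rewrite (_ : col_mx _ _ = col_mx p (usubmx M0) - col_mx q (dsubmx M0)).
    by have := maxd M' GM'; rewrite /M' col_mxKu col_mxKd.
  by rewrite opp_col_mx add_col_mx.
(* The d terms of the expansion of p - q have coefficients at most |c|, so their errors add up to at
   most [e]. *)
pose e' := e / (d%:R * `|c| + 1).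
have dc : 0 < d%:R * `|c| + 1 by rewrite ltr_wpDl// mulr_ge0.
have e'0 : 0 < e' / 2 by rewrite !divr_gt0.
have {}H i : \forall M \near M0 & y \near x, G y (row i M) ->
    `|g y - g x - dot (row i M0) (y - x)| <= e' / 2 * enorm (y - x).
  have [s s0 Hs] := unif_subgrad_near cg x (row i M0) del0 e'0.
  near=> M y => /= Gi.
  have Ms : enorm (row i M - row i M0) < s by near: M; exact: row_near.
  have ys : enorm (y - x) < s by near: y; exact: near_enorm.
  by have [] := Hs _ _ Ms ys Gi.
have FF : Filter (filter_prod (nbhs M0) (nbhs x)) by exact: filter_prod_filter.
have {}H := @filter_forall _ _ _ _ FF H.
apply: (@filterS _ _ FF _ _ _ H) => -[M y] /= HM GM _.
have -> : dot (p - q) (y - x) = \sum_a c ord0 a * dot (row a D0) (y - x).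
  rewrite cE dotE trmx_mul mulmxA mxE; apply: eq_bigr => a _.
  rewrite [X in _ * X]mxE mulrC; congr (_ * _).
  by rewrite /dot mxE; apply: eq_bigr => j _; rewrite [X in _ * X]mxE [row a D0 _ _]mxE mulrC.
apply: le_trans (ler_norm_sum _ _ _) _.
apply: (@le_trans _ _ (\sum_(a < d) `|c| * (e' * enorm (y - x)))).
  apply: ler_sum => a _; rewrite normrM ler_pM ?mx_coord_le_norm//.
  have := HM (lshift d a) (GM _); have := HM (rshift d a) (GM _).
  rewrite /D0 linearB/= dotBl row_usubmx row_dsubmx.
  move: (dot (row (rshift d a) M0) _) (dot (row (lshift d a) M0) _) (g y) (g x) (enorm (y - x)) (e'); clear.
  by move=> a b f i j k; rewrite !ler_norml; lra.
have ce : d%:R * `|c| * e' <= e.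
  by rewrite /e' mulrA ler_pdivrMr// mulrC ler_wpM2l ?(ltW e0)// lerDl.
rewrite sumr_const card_ord -mulr_natl.
apply: le_trans (ler_wpM2r (enorm_ge0 (y - x)) ce).
by rewrite -!mulrA.
Unshelve. all: by end_near. Qed.

(** For each point take the largest [d] for which d independent differences exist, and a natural
    number bounding both the witness and its independence constant. Only countably many pairs
    arise. *)
Lemma nonunique_sigma_tangential :
  sigma_tangential [set x | exists p q, [/\ G x p, G x q & p != q]].
Proof.
apply: (@sigma_tangential_sub _ _ _ (\bigcup_(dk : nat * nat) nonunique dk.1 dk.2%:R)); last first.
  by apply: sigma_tangential_bigcup => dk; apply: tangential_sigma; exact: nonunique_tangential.
move=> x Nx.
pose P d := `[< exists M : 'M[R]_(d + d, n), (forall i, G x (row i M)) /\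
  row_free (usubmx M - dsubmx M) >].
have P0 : exists d, P d.
  exists 0%N; apply/asboolP; exists 0; split; first by case.
  by rewrite /row_free flatmx0 mxrank0.
have Pn d : P d -> (d <= n)%N.
  by move=> /asboolP[M [_ /eqP <-]]; exact: rank_leq_col.
case: (ex_maxnP P0 Pn) => d /asboolP[M [GM fM]] maxd.
have [K K0 HK] := row_free_bound fM.
have K'0 : 0 <= Num.max K `|M| by rewrite le_max K0.
exists (d, (Num.truncn (Num.max K `|M|)).+1) => //.
have Kk : Num.max K `|M| <= (Num.truncn (Num.max K `|M|)).+1%:R.
  by have /andP[_ /ltW] := truncn_itv K'0.
move: Kk; rewrite ge_max => /andP[KK MK].
split=> //=.
  exists M; split=> // c; apply: le_trans (HK c) _.
  by rewrite ler_wpM2r.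
move=> M' GM'; apply/negP => fM'; have := maxd d.+1; rewrite ltnn => H.
by suff : false by []; apply: H; apply/asboolP; exists M'.
Qed.

End nonunique_subgradients.

(** * First-order expansions, contact points and zeros *)

Section expansions.
Context (R : realType) (n : nat).
Implicit Types (f u g : 'rV[R]_n -> R) (x y h p q : 'rV[R]_n) (e : R).

(** Differentiability with gradient [q], in Euclidean norm; the conversions to and from
    [differentiable] follow. *)
Definition has_grad f x q := forall e, 0 < e ->
  \forall y \near x, `|f y - f x - dot q (y - x)| <= e * enorm (y - x).

Lemma dot_is_linear q : linear (dot q : 'rV[R]_n -> R^o).
Proof. by move=> a v w; rewrite dotDr dotZr. Qed.

HB.instance Definition _ q := GRing.isLinear.Build R 'rV[R]_n R^o _ (dot q) (dot_is_linear q).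

Lemma differentiable_has_grad f x : differentiable f x -> exists q, has_grad f x q.
Proof.
move=> df; exists (\row_i 'd f x (delta_mx 0 i)) => e e0.
have lin h : 'd f x h = dot (\row_i 'd f x (delta_mx 0 i)) h.
  rewrite {1}(row_sum_delta h) linear_sum; apply: eq_bigr => i _.
  by rewrite linearZ/= mxE mulrC.
have /diff_locallyP[_ /eqaddoP] := df.
move=> /(_ e e0)/nbhs_enorm[d d0 H]; near=> y.
have yd : enorm (y - x) < d by near: y; exact: near_enorm.
have := H (y - x); rewrite subr0 => /(_ yd).
rewrite /= !fctE /= subrK -lin opprD addrA => /le_trans; apply.
by rewrite ler_wpM2l ?(ltW e0)// norm_le_enorm.
Unshelve. all: by end_near. Qed.

Lemma has_grad_differentiable f x q : has_grad f x q -> differentiable f x.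
Proof.
move=> fq; have E : f \o shift x = cst (f x) + (dot q : 'rV[R]_n -> R^o) +o_ (0 : 'rV[R]_n) id.
  apply/eqaddoP => e e0.
  (* Compensates the passage from the Euclidean norm to the sup norm. *)
  have en0 : 0 < e / n.+1%:R by rewrite divr_gt0.
  have /nbhs_enorm[d d0 H] := fq _ en0; near=> h.
  have hd : enorm (h - 0) < d by near: h; exact: near_enorm.
  rewrite subr0 in hd; have {H} := H (h + x); rewrite addrK => /(_ hd).
  rewrite /= !fctE /= opprD addrA => /le_trans; apply.
  rewrite -mulrA ler_wpM2l ?(ltW e0)// mulrC ler_pdivrMr// mulrC.
  by apply: le_trans (enorm_le_norm h) _; rewrite ler_wpM2r// ler_nat.
have cd : continuous (dot q : 'rV[R]_n -> R^o) by exact: dot_continuous.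
apply/diff_locallyP; have dE := diff_unique cd E.
by rewrite dE; split.
Unshelve. all: by end_near. Qed.

(* If u <= g touch at x, where u has the gradient q while g has a unique uniform
   subgradient p, then u - g vanishes at nearby contact points, which forces
   these to approach x orthogonally to q - p. *)
Lemma contact_tangential u g del : continuous g -> (forall k, 0 < del k) ->
  (forall x, u x <= g x) ->
  tangential [set x | u x = g x /\ exists q p, [/\ has_grad u x q, unif_subgrad g del x p,
    forall p', unif_subgrad g del x p' -> p' = p & p != q]].
Proof.
move=> cg del0 ug; apply: tangential_hyperplane => x [ugx [q [p [uq gp uniq pq]]]].
exists (q - p); first by rewrite subr_eq0 eq_sym.
move=> e e0; have e20 : 0 < e / 2 by rewrite divr_gt0.
near=> y => -[ugy [_ [p' [_ gp' _ _]]]].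
have : `|u y - u x - dot q (y - x)| <= e / 2 * enorm (y - x) by near: y; exact: uq.
have : `|g y - g x - dot p (y - x)| <= e / 2 * enorm (y - x).
  by move: p' gp'; near: y; exact: (unif_subgrad_unique cg del0 e20 uniq).
rewrite dotBl ugy ugx; move: (dot p _) (dot q _) (g y) (g x) (enorm (y - x)); clear.
by move=> a b c d f; rewrite !ler_norml; lra.
Unshelve. all: by end_near. Qed.

(** Between two zeros the expansion of [f] reduces to the linear term, which must therefore be
    small. *)
Lemma zero_set_tangential f :
  tangential [set x | f x = 0 /\ exists2 q, q != 0 & has_grad f x q].
Proof.
apply: tangential_hyperplane => x [fx [q q0 fq]]; exists q => // e e0.
near=> y => -[fy _].
have : `|f y - f x - dot q (y - x)| <= e * enorm (y - x) by near: y; exact: fq.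
by rewrite fx fy subr0 sub0r normrN.
Unshelve. all: by end_near. Qed.

End expansions.

(** * Differentiability of the maximal function *)

Section maximal_differentiability.
Context (R : realType) (n : nat) (u g : 'rV[R]_n -> R).
Hypotheses (cu : continuous u) (u0 : forall x, 0 <= u x).
Hypothesis avg_le_g : forall x (r : R), 0 < r -> avg u x r <= g x.
Hypothesis g_lub : forall x (c : R), (forall r : R, 0 < r -> avg u x r <= c) -> g x <= c.
Implicit Types (x y z h p q : 'rV[R]_n) (r s e d : R).

Let cg : continuous g := maximal_continuous cu u0 avg_le_g g_lub.
Let ug x : u x <= g x := le_maximal cu avg_le_g x.

(* The affine part of u has an exact average, and the remainder w is o(|z - x|):
   on balls of radius r <= |y - x| this suffices, while for larger r the average
   of w over the ball centred at x is nonpositive and moving the centre costs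
   only o(r) |y - x| / r. *)
Lemma contact_upper x q e : u x = g x -> has_grad u x q -> 0 < e ->
  exists2 d : R, 0 < d & forall y r, enorm (y - x) < d -> 0 < r < d ->
    avg u y r <= u x + dot q (y - x) + e * enorm (y - x).
Proof.
(* For r > |y - x| the remainder is at most 2 r eta on the larger ball, and [avg_shift] multiplies
   this by 2 3^n |y - x| / r. *)
move=> ugx uq e0; pose eta := e / (4 * 3 ^+ n).
have eta0 : 0 < eta by rewrite divr_gt0// mulr_gt0// exprn_gt0.
have /nbhs_enorm[d d0 H] := uq _ eta0.
exists (d / 2); first by rewrite divr_gt0.
move=> y r yx /andP[r0 rd].
pose l z := u x + dot q (z - x).
have cl : continuous l.
  apply: continuous_add; first exact: cst_continuous.
  have -> : (fun z => dot q (z - x)) = (fun z => dot q z + (- dot q x)) by apply/funext => z; rewrite dotBr.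
  by apply: continuous_add; [exact: dot_continuous|exact: cst_continuous].
have avgl z : avg l z r = l z.
  have -> : l = (fun z' => l z + dot q (z' - z)).
    apply/funext => z'; rewrite /l -addrA -dotDr; congr (_ + dot q _).
    by rewrite [RHS]addrC addrA subrK.
  rewrite avgD ?avg_cst ?avg_dot//; last 2 first.
  - exact: cst_continuous.
  - have -> : (fun z' => dot q (z' - z)) = (fun z' => dot q z' + (- dot q z)) by apply/funext => z'; rewrite dotBr.
    by apply: continuous_add; [exact: dot_continuous|exact: cst_continuous].
  by rewrite addr0 subrr dot0r addr0.
pose w z := u z + (-1) * l z.
have cw : continuous w by apply: continuous_add => //; exact: continuous_scale.
have avgw z : avg w z r = avg u z r - l z.
  by rewrite avgD ?avgZ ?avgl ?mulN1r//; exact: continuous_scale.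
have wle z s : enorm (z - x) < s -> s <= d -> `|w z| <= eta * s.
  move=> zs sd; rewrite /w /l mulN1r opprD addrA.
  by apply: le_trans (H z (lt_le_trans zs sd)) _; rewrite ler_wpM2l ?(ltW eta0)// ltW.
rewrite -/(l y) -lerBlDl -avgw.
have h0 := enorm_ge0 (y - x).
have one3 : 1 <= 3 ^+ n :> R by rewrite exprn_ege1//; lra.
have c0 : 0 < 4 * 3 ^+ n :> R by rewrite mulr_gt0//; lra.
have [rh|hr] := leP r (enorm (y - x)).
  have Hw z : eball y r z -> - (eta * (r + enorm (y - x))) <= w z <= eta * (r + enorm (y - x)).
    move=> zy; rewrite -ler_norml; apply: wle; last by lra.
    by rewrite -(subrKA y); apply: le_lt_trans (ler_enormD _ _) _; move: zy; rewrite /eball/=; lra.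
  have /andP[_ /le_trans] := avg_bounds r0 cw Hw; apply.
  have : eta * (4 * 3 ^+ n) = e by rewrite /eta divfK// gt_eqF.
  have : eta * 4 <= eta * (4 * 3 ^+ n) by rewrite ler_wpM2l ?(ltW eta0)// ler_peMr.
  move: eta0 h0 rh; move: (3 ^+ n) (eta) (enorm (y - x)); clear => c a b a0 b0 rb H1 H2.
  have H3 : a * 4 <= e by rewrite -H2.
  have := ler_wpM2r b0 H3; have : a * r <= a * b by rewrite ler_wpM2l// ltW.
  have := mulr_ge0 (ltW a0) b0; lra.
have Hw z : eball x (r + enorm (y - x)) z -> `|w z| <= eta * (2 * r).
  by move=> zx; apply: wle; [apply: lt_le_trans zx _; lra|lra].
have := avg_shift r0 (ltW hr) cw Hw; rewrite subrKC => Hs.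
have Hx : avg w x r <= 0 by rewrite avgw subr_le0 /l subrr dot0r addr0 ugx avg_le_g.
have E : eta * (2 * r) * 2 * 3 ^+ n * enorm (y - x) / r = e * enorm (y - x).
  have -> : eta * (2 * r) * 2 * 3 ^+ n * enorm (y - x) / r = eta * (4 * 3 ^+ n) * enorm (y - x) * (r / r) by ring.
  by rewrite divff ?gt_eqF// mulr1 /eta divfK// gt_eqF.
rewrite E in Hs; rewrite -[leLHS](subrK (avg w x r)).
by apply: le_trans (lerD (le_trans (ler_norm _) Hs) Hx) _; rewrite addr0.
Qed.

(** If [x] minimises [g], then p = 0 and recentring a large ball at [x] costs little. Otherwise g(z)
    < g(x) for some [z], and recentring at [z] shows that large radii cannot attain g(y) for [y]
    near [x]. *)
Lemma maximal_far x p e : 0 < e -> ((forall z, g x <= g z) -> p = 0) ->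
  exists2 M : R, 0 < M & \forall y \near x, forall r, M < r -> avg u y r = g y ->
    g y <= g x + dot p (y - x) + e * enorm (y - x).
Proof.
move=> e0 p0; have g0 z : 0 <= g z := maximal_ge0 cu u0 avg_le_g z.
have [minx|] := pselect (forall z, g x <= g z).
  rewrite (p0 minx).
  have K0 : 0 <= 3 ^+ n * g x / e by rewrite divr_ge0 ?(ltW e0)// mulr_ge0// exprn_ge0.
  exists (1 + 3 ^+ n * g x / e); first by lra.
  near=> y => r rM gy.
  have y1 : enorm (y - x) < 1 by near: y; exact: near_enorm.
  have r0 : 0 < r by lra.
  have yr : enorm (y - x) <= r by lra.
  have := avg_le_maximal cu u0 avg_le_g r0 yr; rewrite gy mulrDl mul1r dot0l addr0 => /le_trans; apply.
  rewrite lerD2l (_ : 3 ^+ n * _ * _ = (3 ^+ n * g x) / r * enorm (y - x)); last by ring.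
  rewrite ler_wpM2r ?enorm_ge0// ler_pdivrMr// -ler_pdivrMl// mulrC; lra.
move=> /existsNP[z /negP]; rewrite -ltNge => gzx.
(* Half the difference, so that g(z) + gap = g(x) - gap separates averages over large balls from the
   values of [g] near [x]. *)
pose gap := (g x - g z) / 2; have gap0 : 0 < gap by rewrite divr_gt0// subr_gt0.
have gap20 : 0 < gap / 2 by rewrite divr_gt0.
have e1 := enorm_ge0 (x - z).
have K0 : 0 <= 3 ^+ n * (enorm (x - z) + 1) * g z / gap.
  by rewrite divr_ge0 ?(ltW gap0)// mulr_ge0// mulr_ge0 ?exprn_ge0// addr_ge0.
exists (enorm (x - z) + 1 + 3 ^+ n * (enorm (x - z) + 1) * g z / gap); first by lra.
near=> y => r rM gy; exfalso.
have y1 : enorm (y - x) < 1 by near: y; exact: near_enorm.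
have r0 : 0 < r by lra.
have yz : enorm (y - z) <= enorm (x - z) + 1.
  rewrite -(subrKA x); apply: le_trans (ler_enormD _ _) _; lra.
have yr : enorm (y - z) <= r by lra.
have gxy : g x - gap < g y.
  have : g x - gap / 2 <= g y by near: y; exact: (maximal_lower cu u0 avg_le_g g_lub).
  lra.
have := avg_le_maximal cu u0 avg_le_g r0 yr; rewrite gy mulrDl mul1r.
have : 3 ^+ n * (enorm (y - z) / r) * g z <= gap.
  apply: (@le_trans _ _ (3 ^+ n * (enorm (x - z) + 1) * g z / r)).
    rewrite (_ : 3 ^+ n * (enorm (x - z) + 1) * g z / r = 3 ^+ n * ((enorm (x - z) + 1) / r) * g z); last by ring.
    by rewrite ler_wpM2r// ler_wpM2l ?exprn_ge0// ler_wpM2r// invr_ge0 ltW.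
  rewrite ler_pdivrMr// -ler_pdivrMl// mulrC; lra.
move: gxy; rewrite /gap ltrBlDr => gxy H1 H2; move: (lt_le_trans gxy (lerD H2 (lexx _))).
move: (lerD (lerD (lexx (g z)) H1) (lexx ((g x - g z) / 2))) => /(lt_le_trans _)/[apply].
by rewrite -addrA -splitr subrKC ltxx.
Unshelve. all: by end_near. Qed.

Lemma minimal_unif_subgrad del x : (forall z, g x <= g z) -> unif_subgrad g del x 0.
Proof.
move=> minx k z _; rewrite dot0l addr0; apply: le_trans (minx z).
by rewrite lerBlDr lerDl mulr_ge0 ?enorm_ge0.
Qed.

(** For fixed [r] the average lies below [g] and touches it at [x], so its gradient is a subgradient
    of [g] there. The levels [m] exhaust all centres and all positive radii. *)
Lemma maximal_unif_subgrad : exists2 del : nat -> nat -> R, (forall m k, 0 < del m k) &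
  forall m x r, enorm x <= m.+1%:R -> m.+1%:R^-1 <= r <= m.+1%:R -> avg u x r = g x ->
    exists p, unif_subgrad g (del m) x p.
Proof.
have m1 (m : nat) : 1 <= m.+1%:R :> R by rewrite ler1n.
have H m := avg_uniform_gradient cu (m1 m).
have {H}/choice[del Hdel] : forall m, exists del : nat -> R, (forall k, 0 < del k) /\
    forall x r, enorm x <= m.+1%:R -> m.+1%:R^-1 <= r <= m.+1%:R -> exists p, forall k h, enorm h < del k ->
    `|avg u (x + h) r - avg u x r - dot p h| <= k.+1%:R^-1 * enorm h.
  by move=> m; have [del ? ?] := H m; exists del.
exists del => [m|m x r xm mr gx]; first exact: (Hdel m).1.
have [p Hp] := (Hdel m).2 x r xm mr; exists p => k z zx.
have r0 : 0 < r by have /andP[mr1 _] := mr; apply: lt_le_trans mr1; rewrite invr_gt0.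
have := Hp k _ zx; rewrite subrKC gx; have := avg_le_g z r0.
move: (avg u z r) (g z) (g x) (dot _ _) (_ * _) => a b c f i; rewrite ler_norml; lra.
Qed.

Lemma maximal_differentiable_off (E : set 'rV[R]_n) : sigma_tangential E ->
  (forall x, ~ E x -> exists q, has_grad u x q) ->
  exists F : set 'rV[R]_n, sigma_tangential F /\ forall x, ~ F x -> exists p, has_grad g x p.
Proof.
move=> sE Eu; have [del del0 Hdel] := maximal_unif_subgrad.
(* Subgradients from two levels share the smaller modulus, so off the sets [N1] subgradients of all
   levels coincide. *)
pose del2 (mm : nat * nat) k := Num.min (del mm.1 k) (del mm.2 k).
have del20 mm k : 0 < del2 mm k by rewrite lt_min !del0.
pose N1 mm := [set x | exists p q, [/\ unif_subgrad g (del2 mm) x p, unif_subgrad g (del2 mm) x q & p != q]].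
pose N2 m := [set x | u x = g x /\ exists q p, [/\ has_grad u x q, unif_subgrad g (del m) x p,
    forall p', unif_subgrad g (del m) x p' -> p' = p & p != q]].
exists (E `|` (\bigcup_mm N1 mm `|` \bigcup_m N2 m)); split.
  apply: sigma_tangentialU => //; apply: sigma_tangentialU; apply: sigma_tangential_bigcup.
    by move=> mm; exact: nonunique_sigma_tangential.
  by move=> m; apply: tangential_sigma; exact: contact_tangential.
move=> x /not_orP[/Eu[q uq] /not_orP[nN1 nN2]].
have U m m' p p' : unif_subgrad g (del m) x p -> unif_subgrad g (del m') x p' -> p = p'.
  move=> pm pm'; apply/eqP/negP => /negP pp'; apply: nN1; exists (m, m') => //.
  exists p, p'; split=> // k z; rewrite lt_min => /andP[zm zm']; [exact: pm|exact: pm'].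
(* The candidate gradient: q where g = u, and otherwise the subgradient at [x]. In the latter case
   small radii cannot attain g(y), since averages over small balls stay near u(x) < g(x). *)
have [p [pV plow psmall]] : exists p, [/\ forall m p', unif_subgrad g (del m) x p' -> p' = p,
    forall e, 0 < e -> \forall y \near x, g x + dot p (y - x) - e * enorm (y - x) <= g y &
    forall e, 0 < e -> exists2 d, 0 < d & \forall y \near x,
      (u y = g y \/ exists2 r, 0 < r < d & avg u y r = g y) ->
      g y <= g x + dot p (y - x) + e * enorm (y - x)].
  have [ugx|ugx] := eqVneq (u x) (g x).
    exists q; split=> [m p' gp'|e e0|e e0].
    - apply/eqP/negP => /negP p'q; apply: nN2; exists m => //; split=> //.
      by exists q, p'; split=> // p'' gp''; exact: U gp'' gp'.
    - near=> y; have : `|u y - u x - dot q (y - x)| <= e * enorm (y - x) by near: y; exact: uq.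
      have := ug y; rewrite ugx; move: (u y) (g y) (g x) (dot _ _) (_ * _) => a b c f i.
      by rewrite ler_norml; lra.
    - have [d d0 Hd] := contact_upper ugx uq e0; exists d => //.
      near=> y => -[ugy|[r rd <-]].
        have : `|u y - u x - dot q (y - x)| <= e * enorm (y - x) by near: y; exact: uq.
        rewrite ugx ugy; move: (g y) (g x) (dot _ _) (_ * _) => b c f i.
        by rewrite ler_norml; lra.
      by rewrite -ugx; apply: Hd => //; near: y; exact: near_enorm.
  have uglt : u x < g x by rewrite lt_neqAle ugx ug.
  have [m [p0 mp0]] : exists m p0, unif_subgrad g (del m) x p0.
    case: (maximal_trichotomy cu u0 avg_le_g g_lub x) => [|[r r0 rx]|minx].
    - by move/eqP; rewrite (negbTE ugx).
    - pose M := Num.max (enorm x) (Num.max r^-1 r).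
      have M0 : 0 <= M by rewrite le_max enorm_ge0.
      have /andP[_ /ltW] := truncn_itv M0; rewrite ge_max ge_max => /andP[M1 /andP[M2 M3]].
      exists (Num.truncn M); apply: (Hdel _ x r) => //.
      by rewrite M3 andbT -[leRHS]invrK lef_pV2 ?posrE ?invr_gt0.
    - by exists 0, 0; exact: minimal_unif_subgrad.
  exists p0; split=> [m' p' gp'|e e0|e e0].
  - exact: U gp' mp0.
  - have [k ke] := exists_natSinv_lt e0; near=> y.
    have /mp0 : enorm (y - x) < del m k by near: y; exact: near_enorm.
    apply: le_trans; rewrite lerD2l lerN2 ler_wpM2r ?enorm_ge0//; exact: ltW.
  - pose eta := (g x - u x) / 3.
    have eta0 : 0 < eta by rewrite divr_gt0// subr_gt0.
    have [d d0 Hd] := avg_small_radius cu x eta0; exists d => //.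
    have /cvgrPdist_le/(_ eta eta0) Hc := @cu x.
    near=> y => H; exfalso.
    have gy : g x - eta <= g y by near: y; exact: (maximal_lower cu u0 avg_le_g g_lub).
    case: H => [ugy|[r rd ry]].
      have : `|u x - u y| <= eta by near: y; exact: Hc.
      rewrite ugy; move: gy uglt; rewrite /eta; move: (g x) (g y) (u x).
      by move=> a b c; rewrite ler_norml; lra.
    have yd : enorm (y - x) < d by near: y; exact: near_enorm.
    have := Hd y r yd rd; rewrite ry; move: gy uglt; rewrite /eta; move: (g x) (g y) (u x).
    by move=> a b c; rewrite ler_norml; lra.
exists p => e e0.
have [d d0 Hsmall] := psmall e e0.
have [|M M0 Hfar] := @maximal_far x p e e0.
  by move=> minx; rewrite (pV 0 0)//; exact: minimal_unif_subgrad.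
(* Radii below [d] and above [M] are already handled; level [m] is taken so large that it covers the
   radii in between and all centres within 1 of [x]. *)
pose K := Num.max (enorm x + 1) (Num.max d^-1 M).
have K0 : 0 <= K by rewrite le_max addr_ge0 ?enorm_ge0.
have /andP[_ /ltW] := truncn_itv K0; set m := Num.truncn K.
rewrite ge_max ge_max => /andP[m1 /andP[m2 m3]].
have Hmid := unif_subgrad_unique cg (del0 m) e0 (pV m).
near=> y.
have yx1 : enorm (y - x) < 1 by near: y; exact: near_enorm.
have ym : enorm y <= m.+1%:R.
  by rewrite -(subrK x y); apply: le_trans (ler_enormD _ _) _; lra.
have low : g x + dot p (y - x) - e * enorm (y - x) <= g y by near: y; exact: plow.
have mid p' : unif_subgrad g (del m) y p' -> `|g y - g x - dot p (y - x)| <= e * enorm (y - x).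
  by move: p'; near: y.
have small : (u y = g y \/ exists2 r, 0 < r < d & avg u y r = g y) ->
    g y <= g x + dot p (y - x) + e * enorm (y - x) by near: y.
have far r : M < r -> avg u y r = g y -> g y <= g x + dot p (y - x) + e * enorm (y - x).
  by move: r; near: y.
have fin : g y <= g x + dot p (y - x) + e * enorm (y - x) ->
    `|g y - g x - dot p (y - x)| <= e * enorm (y - x).
  move: low; move: (g y) (g x) (dot p (y - x)) (e * enorm (y - x)).
  by move=> a b c f; rewrite ler_norml; lra.
(* The case of infinite radius needs no separate estimate: the subgradient 0 at [y] belongs to every
   level. *)
case: (maximal_trichotomy cu u0 avg_le_g g_lub y) => [ugy|[r r0 ry]|miny].
- by apply: fin; apply: small; left.
- have [rd|dr] := ltP r d; first by apply: fin; apply: small; right; exists r; rewrite ?r0.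
  have [rM|Mr] := leP r M; last exact/fin/(far r).
  have [|p' yp'] := @Hdel m y r ym _ ry; last exact: mid yp'.
  rewrite (le_trans rM m3) andbT; apply: le_trans dr.
  by rewrite -[leRHS]invrK lef_pV2// posrE ?invr_gt0.
- by apply: mid; exact: minimal_unif_subgrad.
Unshelve. all: by end_near. Qed.

End maximal_differentiability.

(** Where f is nonzero its sign is locally constant; at a zero with vanishing gradient |f| is o(|y -
    x|). *)
Lemma has_grad_norm (R : realType) n (f : 'rV[R]_n -> R) x q : continuous f -> has_grad f x q ->
  (f x = 0 -> q = 0) -> exists p, has_grad (fun y => `|f y|) x p.
Proof.
move=> cf fq q0; have [fx|fx|fx] := ltgtP (f x) 0.
- exists (- q) => e e0; have fx2 : 0 < - f x by rewrite oppr_gt0.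
  have /cvgrPdist_lt/(_ _ fx2) Hc := @cf x; near=> y.
  have : `|f x - f y| < - f x by near: y; exact: Hc.
  have : `|f y - f x - dot q (y - x)| <= e * enorm (y - x) by near: y; exact: fq.
  rewrite (ltr0_norm fx) dotNl => H1; rewrite ltr_norml => /andP[H2 H3].
  have fy : f y < 0 by lra.
  by rewrite (ltr0_norm fy); move: H1; rewrite !ler_norml; lra.
- exists q => e e0; have /cvgrPdist_lt/(_ _ fx) Hc := @cf x; near=> y.
  have : `|f x - f y| < f x by near: y; exact: Hc.
  have : `|f y - f x - dot q (y - x)| <= e * enorm (y - x) by near: y; exact: fq.
  rewrite (gtr0_norm fx) => H1; rewrite ltr_norml => /andP[H2 H3].
  by rewrite (@gtr0_norm _ (f y))//; lra.
- exists 0 => e e0; near=> y.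
  have : `|f y - f x - dot q (y - x)| <= e * enorm (y - x) by near: y; exact: fq.
  by rewrite q0// fx normr0 dot0l !subr0 normr_id.
Unshelve. all: by end_near. Qed.

(** * Finiteness of the maximal function *)

Section maximal_finite.
Context (R : realType) (n : nat) (u : 'rV[R]_n -> R).
Hypotheses (cu : continuous u) (u0 : forall x, 0 <= u x).

(** Up to radius d + 1 the function is bounded on the balls at [x]; beyond it, recentring at [x0]
    costs a factor at most 1 + 3^n. *)
Lemma avg_bounded_transfer x0 x (M : R) : (forall r, 0 < r -> avg u x0 r <= M) ->
  exists C : R, forall r, 0 < r -> avg u x r <= C.
Proof.
move=> x0M; set d := enorm (x - x0); have d0 : 0 <= d := enorm_ge0 _.
have M0 : 0 <= M.
  have r1 : 0 < 1 :> R by [].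
  have := @avg_le R n (fun=> 0) u x0 1 r1 (@cst_continuous _ _ 0) cu; rewrite avg_cst//.
  by move=> /(_ (fun y _ => u0 y)) /le_trans; apply; exact: x0M.
have [C C0 HC] := continuous_bounded_eball x (d + 1) cu.
exists (C + (1 + 3 ^+ n) * M) => r r0.
have CM : 0 <= (1 + 3 ^+ n) * M by rewrite mulr_ge0// addr_ge0// exprn_ge0.
have [rd|dr] := leP r (d + 1).
  have Hb y : eball x r y -> 0 <= u y <= C.
    move=> yr; rewrite u0/= -(ger0_norm (u0 y)); apply: HC.
    by move: yr; rewrite /eball/= => /lt_le_trans; apply.
  have /andP[_ /le_trans] := avg_bounds r0 cu Hb; apply.
  by rewrite lerDl.
have xr : enorm (x - x0) <= r by rewrite -/d; lra.
apply: le_trans (avg_le_shift cu u0 r0 xr) _; rewrite -/d.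
apply: (@le_trans _ _ ((1 + 3 ^+ n) * M)); last by rewrite lerDr.
have d1 : d / r <= 1 by rewrite ler_pdivrMr// mul1r.
have dr0 : 0 <= d / r by rewrite divr_ge0// ltW.
apply: ler_pM.
- by rewrite addr_ge0// mulr_ge0// exprn_ge0.
- have rd0 : 0 < r + d by lra.
  have := @avg_le R n (fun=> 0) u x0 (r + d) rd0 (@cst_continuous _ _ 0) cu; rewrite avg_cst//.
  by apply => y _.
- by rewrite lerD2l ler_piMr// exprn_ge0.
- by apply: x0M; lra.
Qed.

End maximal_finite.

Unset Implicit Arguments.

Theorem theorem1p2 (R : realType) (n : nat) (n_gt0 : (0 < n)%N)
    (f : 'rV[R]_n -> R)
    (f_cont : continuous f)
    (f_diff : exists E : set 'rV[R]_n,
      sigma_tangential E /\ forall x, ~ E x -> differentiable f x)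
    (Mf_fin : ~ (forall x, maximal f x = +oo%E)) :
  [/\ forall x, maximal f x \is a fin_num,
      continuous (fun x => fine (maximal f x)) &
      exists E : set 'rV[R]_n, sigma_tangential E /\
        forall x, ~ E x -> differentiable (fun x => fine (maximal f x)) x].
Proof.
pose u (x : 'rV[R]_n) := `|f x|.
have cu : continuous u by move=> x; apply: continuous_comp; [exact: f_cont|exact: norm_continuous].
have u0 x : 0 <= u x by rewrite normr_ge0.
have maxE x : maximal f x = ereal_sup [set (avg u x r)%:E | r in [set r : R | 0 < r]] by exact: maximalE.
have max_ge x r : 0 < r -> ((avg u x r)%:E <= maximal f x)%E.
  by move=> r0; rewrite maxE; apply: ereal_sup_ubound; exists r.
have max_le x (c : R) : (forall r, 0 < r -> avg u x r <= c) -> (maximal f x <= c%:E)%E.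
  by move=> H; rewrite maxE; apply: ge_ereal_sup => _ [r /= r0 <-]; rewrite lee_fin H.
have max_gtNy x : maximal f x != -oo%E.
  by rewrite -ltNye; apply: lt_le_trans (max_ge x 1 ltr01); rewrite ltNyr.
have fin x : maximal f x \is a fin_num.
  move/existsNP : Mf_fin => [x0 x0y].
  have x0fin : maximal f x0 \is a fin_num by rewrite fin_numE max_gtNy; apply/eqP.
  have [C HC] := @avg_bounded_transfer R n u cu u0 x0 x (fine (maximal f x0))
    (fun r r0 => ltac:(by rewrite -lee_fin fineK// max_ge)).
  by rewrite fin_numE max_gtNy lt_eqF// (le_lt_trans (max_le x C HC))// ltry.
pose g x := fine (maximal f x).
have avg_le_g x (r : R) : 0 < r -> avg u x r <= g x.
  by move=> r0; rewrite -lee_fin fineK// max_ge.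
have g_lub x (c : R) : (forall r : R, 0 < r -> avg u x r <= c) -> g x <= c.
  by move=> H; rewrite -lee_fin fineK// max_le.
split=> //; first exact: maximal_continuous cu u0 avg_le_g g_lub.
have [E [sE Ef]] := f_diff.
(* At these points |f| has a corner, so they join the exceptional set before the result for [u] is
   applied. *)
pose Z := [set x | f x = 0 /\ exists2 q, q != 0 & has_grad f x q].
have [F [sF Fg]] : exists F : set 'rV[R]_n, sigma_tangential F /\
    forall x, ~ F x -> exists p, has_grad g x p.
  apply: (maximal_differentiable_off cu u0 avg_le_g g_lub (E := E `|` Z)).
    by apply: sigma_tangentialU => //; apply: tangential_sigma; exact: zero_set_tangential.
  move=> x /not_orP[/Ef/differentiable_has_grad[q fq] nZ].
  apply: (has_grad_norm f_cont fq) => fx0; apply/eqP/negP => /negP q0.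
  exact: (nZ (conj fx0 (ex_intro2 _ _ q q0 fq))).
by exists F; split=> // x /Fg[p]; exact: has_grad_differentiable.
Qed.
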